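(* Let $\{(w^k,x^k)\}$ be the sequence generated by algorithm PSNP or PCSNP with $\alpha_k\equiv\alpha\in\left(0,\min\{\tau,\frac{1}{\sigma+\sigma_0}\}\right]$. Suppose $f$ is $LC^1$ on $\mathbb{N}(0,c_0)$ and, if $q=0$, that $f$ is coercive. Let $x^*$ be an accumulation point of $\{x^k\}$, $S^*:=\mathrm{supp}(x^* )$, and $S^k:=\mathrm{supp}(w^k)$. 1) (Support identification) There is a finite $k_0$ such that $S^k=\mathrm{supp}(x^k)=S^*$ for all $k\ge k_0$. 2) (Sequence convergence) If $\langle M^*v,v\rangle>0$ for all $M^*\in\partial^2_{S^*}E(x^* )$ and all nonzero $v\in\mathbb{R}^{|S^*|}$, then the whole sequence $\{x^k\}$ converges to $x^*$, which is a P-stationary point (with constant $\alpha$) and also a unique local minimizer of $F$.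
   Context: Problem: $f:\mathbb{R}^n\to\mathbb{R}$ is continuously differentiable and bounded from below, $\lambda>0$, $q\in[0,1)$, and $F(x):=f(x)+\lambda\|x\|_q^q$ with $\|x\|_q^q:=\sum_i|x_i|^q$, where $|t|^0=1$ for $t\ne0$ and $|0|^0=0$. $\|\cdot\|$ is the Euclidean/spectral norm. $\mathrm{supp}(x)$ is the set of indices of nonzero entries; $x_T$, $\nabla_Tf$ denote sub-vectors indexed by $T$, $H_T$ the principal sub-matrix indexed by $T$, $\overline T$ the complement of $T$. $\mathbb{N}(x,\epsilon):=\{w:\|x-w\|^2<\epsilon\}$. $f$ is coercive if $f(x)\to\infty$ as $\|x\|\to\infty$. $LC^1$: $f$ is $LC^1$ on an open set $\Omega$ if it is continuously differentiable and $\nabla f$ is Lipschitz on $\Omega$ (with some constant $L$). Generalized Hessian: $\partial^2 g(x)$ is the convex hull of all $H=\lim\nabla^2g(x^i)$ over sequences $x^i\to x$ of points at which $g$ is twice differentiable. $E(x;T):=f(x)+\lambda\|x_T\|_q^q$; for $S=\mathrm{supp}(x)$, $\nabla_SE(x):=(\nabla E(\cdot;S)(x))_S$ and $\partial^2_SE(x):=\{M_S:M\in\partial^2E(\cdot;S)(x)\}$. $\mathrm{Prox}_{r}(z):=\operatorname{argmin}_{w}\frac12\|z-w\|^2+r(w)$ (set of global minimizers). $x^*$ is P-stationary with constant $\alpha>0$ if $x^*\in\mathrm{Prox}_{\alpha\lambda\|\cdot\|_q^q}(x^*-\alpha\nabla f(x^* ))$. Unique local minimizer means: there are $\eta_*>0$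 and a neighbourhood of $x^*$ on which $F(x)\ge F(x^* )+\eta_*\|x-x^*\|^2$. Constants: for the initial point $x^0$ and a given $\tau>0$, $\Omega^0:=\{x:F(x)\le F(x^0)\}$, $c_0:=\sup_{x\in\Omega^0}5(\|x\|^2+\tau^2\|\nabla f(x)\|^2+\tau\lambda\|x\|_q^q)$, $\sigma_0:=\sup_{x\in\mathbb{N}(0,c_0)}\sup_{H\in\partial^2f(x)}\|H\|$. Algorithm PSNP: given $x^0\in\mathbb{R}^n$, $\sigma>0$, $\gamma\in(0,1)$, for $k=0,1,2,\dots$: (i) take $w^k\in\mathrm{Prox}_{\alpha_k\lambda\|\cdot\|_q^q}(x^k-\alpha_k\nabla f(x^k))$ and set $S^k=\mathrm{supp}(w^k)$; the step $\alpha_k$ is to be such that $F(w^k)\le F(x^k)-\frac\sigma4\|w^k-x^k\|^2$ (this holds for the choice of $\alpha_k$ above); (ii) choose $M^k\in\partial^2_{S^k}E(w^k)$; if the equations $M^kd^k_{S^k}=\nabla_{S^k}E(w^k)$, $d^k_{\overline{S^k}}=0$ have a solution $d^k$ and a finite integer $s_k$ is found with $F(w^k-\gamma^{s_k}d^k)\le F(w^k)-\frac\sigma2\|\gamma^{s_k}d^k\|^2$, set $\beta_k=\gamma^{s_k}$ and $x^{k+1}=w^k-\beta_kd^k$; otherwise set $x^{k+1}=w^k$. Algorithm PCSNP is the same except that step (ii) is tried only when $S^k=\mathrm{supp}(x^k)$; otherwise $x^{k+1}=w^k$. Standing assumption: $\nabla f(0)\neq0$ and $\lambda<\frac{\alpha^{1-q}}{2}\|\nabla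 f(0)\|_\infty^{2-q}$. *)

(* Defs.v *)
From HB Require Import structures.
From mathcomp Require Import all_boot all_order all_algebra.
From mathcomp Require Import all_classical all_reals all_analysis.
Import Order.TTheory GRing.Theory Num.Theory.
Import numFieldNormedType.Exports.

Set Implicit Arguments.
Unset Strict Implicit.
Unset Printing Implicit Defensive.

Local Open Scope classical_set_scope.
Local Open Scope ring_scope.

(* Vectors of R^n are row vectors, and a matrix M acts on v as [v *m M]; this
   is the convention of the library's Jacobian ['J].  The library norm [`|x|]
   on matrices is the maximum norm; it induces the same topology as the
   Euclidean norm, hence the same limits, neighbourhoods and differentials. *)

Section Vectors.
Context {R : realType}.

Definition dotv n (u v : 'rV[R]_n) : R := \sum_(i < n) u ord0 i * v ord0 i.

Definition enorm n (x : 'rV[R]_n) : R := Num.sqrt (dotv x x).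

Definition spectral_norm n (H : 'M[R]_n) : R :=
  sup [set enorm (v *m H) | v in [set v : 'rV[R]_n | enorm v <= 1]].

(* The radius bounds the squared distance. *)
Definition nball n (x : 'rV[R]_n) (e : R) : set 'rV[R]_n :=
  [set w | enorm (x - w) ^+ 2 < e].

Definition supp n (x : 'rV[R]_n) : {set 'I_n} := [set i | x ord0 i != 0]%SET.

Definition subv n (T : {set 'I_n}) (x : 'rV[R]_n) : 'rV[R]_#|T| :=
  colsub (fun j : 'I_#|T| => enum_val j) x.

Definition principal_submx n (T : {set 'I_n}) (M : 'M[R]_n) : 'M[R]_#|T| :=
  mxsub (fun j : 'I_#|T| => enum_val j) (fun j : 'I_#|T| => enum_val j) M.

(* The case t = 0 is separate because the library has 0 `^ 0 = 1. *)
Definition abspow (q t : R) : R := if t == 0 then 0 else `|t| `^ q.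

Definition lqq (q : R) n (x : 'rV[R]_n) : R := \sum_(i < n) abspow q (x ord0 i).

Definition coercive n (f : 'rV[R]_n -> R) : Prop :=
  forall A : R, exists B : R, forall x, B <= enorm x -> A <= f x.

Definition bounded_below n (f : 'rV[R]_n -> R) : Prop :=
  exists m : R, forall x, m <= f x.

Definition convex_hull (V : lmodType R) (A : set V) : set V :=
  [set y | exists k (t : 'I_k -> R) (a : 'I_k -> V),
    [/\ forall i, 0 <= t i, \sum_(i < k) t i = 1,
        forall i, A (a i) & y = \sum_(i < k) t i *: a i]].

Definition argmin (T : Type) (g : T -> R) : set T :=
  [set w | forall v, g w <= g v].

End Vectors.

Section Smoothness.
Context {R : realType} {n : nat}.
Implicit Types (f g : 'rV[R]_n -> R) (x : 'rV[R]_n) (Omega : set 'rV[R]_n).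

Definition grad f x : 'rV[R]_n := \row_i 'D_(delta_mx ord0 i) f x.

Definition C1_on f Omega : Prop :=
  forall x, Omega x -> differentiable f x /\ {for x, continuous (grad f)}.

Definition LC1_on f Omega : Prop :=
  C1_on f Omega /\
  exists L : R, forall x y, Omega x -> Omega y ->
    enorm (grad f x - grad f y) <= L * enorm (x - y).

Definition twice_differentiable g x : Prop :=
  (\forall y \near x, differentiable g y) /\ differentiable (grad g) x.

Definition hess g x : 'M[R]_n := 'J (grad g) x.

Definition gen_hess g x : set 'M[R]_n :=
  @convex_hull R 'M[R]_n [set H | exists u : nat -> 'rV[R]_n,
    [/\ u @ \oo --> x, forall i, twice_differentiable g (u i) &
        (fun i => hess g (u i)) @ \oo --> H]].

End Smoothness.

Section Problem.
Context {R : realType} {n : nat}.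
Variables (f : 'rV[R]_n -> R) (lambda q : R).

Definition Fobj (x : 'rV[R]_n) : R := f x + lambda * lqq q x.

Definition Epart (T : {set 'I_n}) (x : 'rV[R]_n) : R :=
  f x + lambda * lqq q (subv T x).

Definition gradE (x : 'rV[R]_n) : 'rV[R]_#|supp x| :=
  subv (supp x) (grad (Epart (supp x)) x).

Definition hessE (x : 'rV[R]_n) : set 'M[R]_#|supp x| :=
  principal_submx (supp x) @` gen_hess (Epart (supp x)) x.

Definition prox (r : 'rV[R]_n -> R) (z : 'rV[R]_n) : set 'rV[R]_n :=
  argmin (fun w => 2^-1 * enorm (z - w) ^+ 2 + r w).

Definition prox_point (alpha : R) (x : 'rV[R]_n) : set 'rV[R]_n :=
  prox (fun w => alpha * lambda * lqq q w) (x - alpha *: grad f x).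

Definition P_stationary (alpha : R) (x : 'rV[R]_n) : Prop :=
  prox_point alpha x x.

Definition unique_local_minimizer (x : 'rV[R]_n) : Prop :=
  exists2 eta : R, 0 < eta &
    \forall y \near x, Fobj x + eta * enorm (y - x) ^+ 2 <= Fobj y.

(* [sup] is the real supremum, which is a default value on unbounded sets.
   The sets below are bounded when f is C^1 and bounded below, F is coercive
   and f is LC^1 on N(0, c0). *)
Definition sublevel (x0 : 'rV[R]_n) : set 'rV[R]_n :=
  [set x | Fobj x <= Fobj x0].

Definition c0 (tau : R) (x0 : 'rV[R]_n) : R :=
  sup [set 5 * (enorm x ^+ 2 + tau ^+ 2 * enorm (grad f x) ^+ 2
                + tau * lambda * lqq q x) | x in sublevel x0].

Definition sigma0 (tau : R) (x0 : 'rV[R]_n) : R :=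
  sup [set sup [set spectral_norm H | H in gen_hess f x]
      | x in nball 0 (c0 tau x0)].

Variables (sigma gamma : R).

Definition prox_step (alpha : R) (x w : 'rV[R]_n) : Prop :=
  prox_point alpha x w /\
  Fobj w <= Fobj x - sigma / 4 * enorm (w - x) ^+ 2.

Definition newton_dir (w : 'rV[R]_n) (M : 'M[R]_#|supp w|) : set 'rV[R]_n :=
  [set d | subv (supp w) d *m M = gradE w /\ subv (~: supp w)%SET d = 0].

Definition newton_exponent (w d : 'rV[R]_n) : set int :=
  [set s : int | Fobj (w - gamma ^ s *: d)
                 <= Fobj w - sigma / 2 * enorm (gamma ^ s *: d) ^+ 2].

Definition newton_step (w x' : 'rV[R]_n) : Prop :=
  exists2 M, @hessE w M &
    (newton_dir M = set0 /\ x' = w) \/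
    (exists2 d, newton_dir M d &
       (newton_exponent w d = set0 /\ x' = w) \/
       (exists2 s, newton_exponent w d s & x' = w - gamma ^ s *: d)).

Definition PSNP (alpha : nat -> R) (x0 : 'rV[R]_n) (w x : nat -> 'rV[R]_n) :
    Prop :=
  x 0%N = x0 /\
  forall k, prox_step (alpha k) (x k) (w k) /\ newton_step (w k) (x k.+1).

Definition PCSNP (alpha : nat -> R) (x0 : 'rV[R]_n) (w x : nat -> 'rV[R]_n) :
    Prop :=
  x 0%N = x0 /\
  forall k, prox_step (alpha k) (x k) (w k) /\
    (if supp (w k) == supp (x k) then newton_step (w k) (x k.+1)
     else x k.+1 = w k).

End Problem.

Arguments hessE {R n} f lambda q x _.

(* Main.v *)
(** Support identification: the two descent inequalities force
    [w k - x k -> 0] and [x k.+1 - w k -> 0], while the nonzero entries of a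
    prox point are bounded away from 0; so the supports are eventually
    constant, equal to [supp xs].

    Convergence: [xs] is P-stationary because the prox map has a closed graph.
    The crux is quadratic growth of [F] at [xs], i.e. strong monotonicity of
    the gradient of [E] along the coordinate subspace of [supp xs], from
    positivity of the generalized Hessians.  A generalized Hessian only sees
    the points where the gradient is differentiable, so Rademacher's theorem is
    needed.  Differentiability almost everywhere on lines comes from the
    Radon-Nikodym theorem.  The passage from partial derivatives to the full
    derivative follows the porosity argument of Preiss and Zajicek: the points
    where a function is differentiable along two complementary subspaces but
    not along their sum form a countable union of sets that are porous, hence
    null, on every line of one coordinate direction.  By Fubini almost every
    line in a given direction then meets the nondifferentiability set in a null
    set, and integrating the Hessian along such lines gives strong
    monotonicity.  Finally quadratic growth, decrease of [F] and vanishing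
    steps trap the iterates near [xs]. *)

Require Import Defs.
From HB Require Import structures.
From mathcomp Require Import all_boot all_order all_algebra.
From mathcomp Require Import all_classical all_reals all_analysis.
From mathcomp Require Import measurable_realfun ring lra.
Import Order.TTheory GRing.Theory Num.Theory.
Import numFieldNormedType.Exports.
Local Open Scope classical_set_scope.
Local Open Scope ring_scope.

Set Implicit Arguments.
Unset Strict Implicit.
Unset Printing Implicit Defensive.

(** * Lipschitz functions on the line *)

(** Positivity is given only at [xs], for limits of Hessians, so it first has to spread: near [xs]
    the Hessians are bounded by the Lipschitz constant of the gradient, and compactness turns
    pointwise positivity into one lower bound for the quadratic form on a whole neighbourhood. That
    bound speaks only of points of twice differentiability, and a given segment may miss all of
    them; hence the detour through parallel segments. Off the support of [xs] the growth is of first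
    order: since [q < 1], the penalty [|t|^q] exceeds any multiple of [|t|] near 0 and absorbs the
    variation of [f]. For [q = 0] the function [F] is discontinuous at every point with a zero
    entry. Limits of values of [F] are therefore taken only after the supports have been identified:
    on vectors vanishing off the support of [xs], [F] coincides with [Epart], which is
    differentiable near [xs]. The estimates for [abspow] treat [q = 0] and [0 < q < 1] together. *)

Lemma lebesgue_stieltjes_itvoc (R : realType) (c : cumulative R R) (a b : R) :
  a <= b -> lebesgue_stieltjes_measure c `]a, b] = (c b - c a)%:E.
Proof.
move=> ab; rewrite /lebesgue_stieltjes_measure /measure_extension/=.
rewrite measurable_mu_extE/=; last exact: is_ocitv.
by rewrite wlength_itv_bnd.
Qed.

(* The Stieltjes measures of [c] and [c'] add up to [L] times Lebesgue measure. *)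
Lemma lebesgue_stieltjes_dominated (R : realType) (c c' : cumulative R R) (L : R) :
  0 < L -> (forall x, c x + c' x = L * x) ->
  lebesgue_stieltjes_measure c `<< (@lebesgue_measure R).
Proof.
move=> L0 cc' A nA.
have Li0 : 0 <= L^-1 by rewrite invr_ge0 ltW.
pose m := mscale (NngNum Li0) (measure_add (lebesgue_stieltjes_measure c) (lebesgue_stieltjes_measure c')).
have mE B : m B = ((L^-1)%:E * (lebesgue_stieltjes_measure c B + lebesgue_stieltjes_measure c' B))%E.
  by rewrite -measure_addE.
have E : forall B, measurable B -> lebesgue_measure B = m B.
  apply: lebesgue_measure_unique => X /ocitvP[->|[[a b] /= ab ->]].
    by rewrite !measure0.
  rewrite [RHS]mE !lebesgue_stieltjes_itvoc ?ltW// lebesgue_measure_itv/= lte_fin ab.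
  rewrite -EFinD -EFinM; congr (_%:E).
  rewrite addrACA -opprD !cc'; field; exact: lt0r_neq0.
move=> B mB BA; have := nA B mB BA.
rewrite E// [LHS]mE => /eqP.
rewrite mule_eq0 eqe invr_eq0 gt_eqF//= => /eqP h.
apply/eqP; rewrite eq_le measure_ge0 andbT -h; exact: leeDl.
Qed.

(** Since [L * x - psi x] is nondecreasing as well, the Stieltjes measure of [psi] is dominated by
    Lebesgue measure. Its Radon-Nikodym density [h] has a primitive that is differentiable almost
    everywhere with derivative [h]. *)
Lemma lipschitz_nondecreasing_density (R : realType) (psi : R -> R) (L N : R) :
  (forall x y, x <= y -> psi x <= psi y) ->
  (forall x y, x <= y -> psi y - psi x <= L * (y - x)) ->
  0 < L ->
  exists h : R -> R, [/\ (@lebesgue_measure R).-integrable setT (EFin \o h),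
   forall a b, - N <= a -> a <= b -> b <= N ->
     (psi b - psi a)%:E = (\int[lebesgue_measure]_(x in `]a, b]) (h x)%:E)%E &
   {ae (@lebesgue_measure R), forall x, - N < x -> x < N ->
      is_derive x (1:R) psi (h x)}].
Proof.
move=> nd lip L0.
have ctsW (g : R -> R) : (forall x y, x <= y -> g x <= g y) ->
   (forall x y, x <= y -> g y - g x <= L * (y - x)) -> continuous g.
  move=> ndg lipg x; apply/cvgrPdist_le => e e0.
  near=> t.
  have H : `|g x - g t| <= L * `|x - t|.
    have [xt|/ltW tx] := leP x t.
      by rewrite distrC ger0_norm ?subr_ge0 ?ndg// distrC ger0_norm ?subr_ge0// lipg.
    by rewrite ger0_norm ?subr_ge0 ?ndg// ger0_norm ?subr_ge0// lipg.
  apply: (le_trans H); rewrite -ler_pdivlMl//.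
  near: t; apply: (@cvgr_dist_le _ _ _ _ _ id) => //; by rewrite mulr_gt0// invr_gt0.
have ctspsi := ctsW _ nd lip.
pose psi' x := L * x - psi x.
have nd' : forall x y, x <= y -> psi' x <= psi' y.
  by move=> x y xy; have := lip _ _ xy; rewrite /psi'; lra.
have lip' : forall x y, x <= y -> psi' y - psi' x <= L * (y - x).
  by move=> x y xy; have := nd _ _ xy; rewrite /psi'; lra.
have ctspsi' := ctsW _ nd' lip'.
pose c : cumulative R R := HB.pack psi (@isCumulative.Build R _ R psi nd (right_continuousW ctspsi)).
pose c' : cumulative R R := HB.pack psi' (@isCumulative.Build R _ R psi' nd' (right_continuousW ctspsi')).
have dom : lebesgue_stieltjes_measure c `<< (@lebesgue_measure R).
  apply: (@lebesgue_stieltjes_dominated _ c c' L) => // x; rewrite /= /psi'; ring.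
(* Restricting to a bounded window makes the measure finite, so that it is a charge; the window can
   be taken as large as desired. *)
pose D : set (measurableTypeR R) := `]- N, N]%classic.
have mD : measurable D by exact: measurable_itv.
have Dfin : (lebesgue_stieltjes_measure c D < +oo)%E.
  rewrite /D; have [NN|NN] := leP (-N) N.
    by rewrite lebesgue_stieltjes_itvoc// ltry.
  by rewrite set_itv_ge ?measure0 ?ltry// bnd_simp -leNgt ltW.
pose nu : {finite_measure set (measurableTypeR R) -> \bar R} := mfrestr mD Dfin.
have nudom : charge_of_finite_measure nu `<< (@lebesgue_measure R).
  move=> A nA B mB BA; rewrite /charge_of_finite_measure /nu /= /mfrestr /mrestr.
  apply: (dom A nA); first exact: measurableI.
  by apply: subset_trans BA; exact: subIsetl.
pose H := Radon_Nikodym (charge_of_finite_measure nu) (@lebesgue_measure R).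
pose h := fine \o H.
have hE : EFin \o h = H.
  by apply/funext => x; rewrite /h /= fineK// Radon_Nikodym_fin_num.
have hint : (@lebesgue_measure R).-integrable setT (EFin \o h).
  by rewrite hE; exact: Radon_Nikodym_integrable.
have psih : forall a b, - N <= a -> a <= b -> b <= N ->
     (psi b - psi a)%:E = (\int[lebesgue_measure]_(x in `]a, b]) (h x)%:E)%E.
  move=> a b Na ab bN.
  rewrite (eq_integral (fun x => H x)); last by move=> x _; rewrite -hE.
  rewrite -Radon_Nikodym_integral//.
  rewrite /charge_of_finite_measure /nu /= /mfrestr /mrestr setIidl.
    by rewrite lebesgue_stieltjes_itvoc.
  by apply: subset_itv; rewrite bnd_simp.
exists h; split => //.
(* The primitive [F] starts at [- N] and differs from [psi] by the constant [psi (- N)] near each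
   point of the window. *)
have := @FTC1 R h (BRight (- N)).
have hintS (y : R) : (@lebesgue_measure R).-integrable `]- N, y] (EFin \o h).
  by apply: integrableS hint => //; exact: measurable_itv.
move/(_ hintS (open_integrable_locally openT hint)).
set F := fun x => _.
apply: filterS; first exact: (ae_filter_ringOfSetsType lebesgue_measure).
move=> x /= + Nx xN; rewrite lte_fin => /(_ Nx)[dF F'].
have nearE : \forall t \near x, psi t = F t + psi (- N).
  near=> t.
  have Nt : - N <= t by apply/ltW; near: t; exact: lt_nbhsr.
  have tN : t <= N by apply/ltW; near: t; exact: lt_nbhsl.
  apply/eqP; rewrite -subr_eq; apply/eqP.
  by rewrite /F /Rintegral -psih.
have dF' : is_derive x (1:R) (F + cst (psi (-N))) (h x).
  rewrite -[h x]addr0 -F' derive1E.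
  by apply: is_deriveD; exact: DeriveDef.
apply: near_eq_is_derive dF'.
by near=> t; apply/esym; near: t.
Unshelve. all: by end_near. Qed.

Section Tilt.
Context {R : realType} (phi : R -> R) (L K : R).
Hypothesis philip : forall x y, `|phi x - phi y| <= L * `|x - y|.
Hypothesis LK : L <= K.

(** Adding a slope [K >= L] turns a Lipschitz function into a nondecreasing one with slopes at most
    [2 * K], which reduces everything to the monotone case. *)
Let tilt (x : R) := phi x + K * x.

Lemma tilt_nondecreasing x y : x <= y -> tilt x <= tilt y.
Proof.
move=> xy; have := philip x y; rewrite distrC [`|x - y|]distrC.
rewrite (ger0_norm (_ : 0 <= y - x)) ?subr_ge0// ler_norml => /andP[+ _].
have : L * (y - x) <= K * (y - x) by rewrite ler_wpM2r// subr_ge0.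
by rewrite /tilt; lra.
Qed.

Lemma tilt_lipschitz x y : x <= y -> tilt y - tilt x <= (2 * K) * (y - x).
Proof.
move=> xy; have := philip x y; rewrite distrC [`|x - y|]distrC.
rewrite (ger0_norm (_ : 0 <= y - x)) ?subr_ge0// ler_norml => /andP[_ +].
have : L * (y - x) <= K * (y - x) by rewrite ler_wpM2r// subr_ge0.
by rewrite /tilt; lra.
Qed.

Lemma is_derive_tilt (x d : R) :
  is_derive x (1 : R) tilt d -> is_derive x (1 : R) phi (d - K).
Proof.
move=> dt.
have -> : phi = tilt - (K *: (@idfun R)).
  by apply/funext => y; rewrite !fctE /tilt /= addrK.
rewrite -{2}[K]mulr1; exact: is_deriveB.
Qed.

End Tilt.

Lemma lipschitz_ae_derivable (R : realType) (phi : R -> R) (L : R) :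
  (forall x y, `|phi x - phi y| <= L * `|x - y|) ->
  {ae (@lebesgue_measure R), forall x, derivable phi x 1}.
Proof.
move=> philip; pose K := `|L| + 1.
have LK : L <= K by rewrite (le_trans (ler_norm _))// lerDl.
have K0 : 0 < 2 * K by rewrite mulr_gt0// ltr_wpDl.
have : forall N : nat, {ae (@lebesgue_measure R), forall x, `|x| < N%:R -> derivable phi x 1}.
  move=> N.
  have [h [_ _]] := @lipschitz_nondecreasing_density R _ (2 * K) N%:R
    (tilt_nondecreasing philip LK) (tilt_lipschitz philip LK) K0.
  apply: (@filterS _ _ (ae_filter_ringOfSetsType lebesgue_measure)) => x H; rewrite ltr_norml => /andP[/H{}H/H].
  by move/is_derive_tilt; case.
move/ae_foralln; apply: (@filterS _ _ (ae_filter_ringOfSetsType lebesgue_measure)).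
move=> x H.
by apply: (H (Num.bound x)); have := archi_boundP (normr_ge0 x); rewrite /Num.bound normr_id.
Qed.

Lemma lipschitz_increment_ge (R : realType) (phi : R -> R) (L eta a b : R) :
  (forall x y, `|phi x - phi y| <= L * `|x - y|) -> a <= b ->
  {ae (@lebesgue_measure R), forall x, a < x -> x < b ->
    forall d, is_derive x (1 : R) phi d -> eta <= d} ->
  eta * (b - a) <= phi b - phi a.
Proof.
(* The summand [|eta|] makes [eta + K] nonnegative, so that the integrals compared at the end are
   those of nonnegative functions; the summand 1 makes [2 * K] positive whatever the sign of [L]. *)
move=> philip ab H; pose K := `|L| + 1 + `|eta|.
have LK : L <= K by rewrite (le_trans (ler_norm _))// /K -addrA lerDl addr_ge0.
have K0 : 0 < 2 * K by rewrite mulr_gt0// ltr_wpDr// ltr_wpDl.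
have eK0 : 0 <= eta + K.
  have : - eta <= `|eta| by rewrite -normrN ler_norm.
  have := normr_ge0 L; rewrite /K; lra.
pose N := `|a| + `|b|.
have Na : - N <= a by rewrite /N; have := normr_ge0 b; have := ler_norm (- a); rewrite normrN; lra.
have bN : b <= N by rewrite /N; have := normr_ge0 a; have := ler_norm b; lra.
have [h [ih psih dh]] := @lipschitz_nondecreasing_density R _ (2 * K) N
    (tilt_nondecreasing philip LK) (tilt_lipschitz philip LK) K0.
suff : (((eta + K) * (b - a))%:E <= ((phi b + K * b) - (phi a + K * a))%:E)%E.
  by rewrite lee_fin; lra.
rewrite psih//.
have mh : measurable_fun setT h by apply/measurable_EFinP; case/integrableP: ih.
(* The derivative bound holds only almost everywhere. Replacing the density by its maximum with
   [eta + K] leaves the integral unchanged and makes the bound hold everywhere. *)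
rewrite (@ae_eq_integral _ _ _ _ _ (fun x : measurableTypeR R => (Num.max (h x) (eta + K))%:E)) => //; last 3 first.
- by apply/measurable_EFinP; exact: measurable_funS mh.
- apply/measurable_EFinP; apply: measurable_maxr => //.
  exact: measurable_funS mh.
- have nb : {ae (@lebesgue_measure R), forall x, x != b}.
    exists [set b]; split => //; first exact: lebesgue_measure_set1.
    by move=> x /= /negP; rewrite negbK => /eqP.
  move: H dh nb; apply: (@filterS3 _ _ (ae_filter_ringOfSetsType lebesgue_measure)) => x /= H1 H2 xb.
  rewrite in_itv/= => /andP[ax]; rewrite le_eqVlt (negbTE xb)/= => xb'.
  rewrite max_l//.
  have := H1 ax xb' _ (is_derive_tilt (H2 (le_lt_trans Na ax) (lt_le_trans xb' bN))).
  by lra.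
have -> : ((eta + K) * (b - a))%:E = (\int[lebesgue_measure]_(x in `]a, b]) (cst (eta + K)%:E x))%E.
  rewrite integral_cst//= lebesgue_measure_itv/= lte_fin.
  case: ltP => [_|ba]; first by rewrite -EFinB EFinM.
  by have -> : b = a; [apply/eqP; rewrite eq_le ab ba | rewrite subrr mulr0 mule0].
apply: ge0_le_integral => //=.
- by apply/measurable_EFinP; apply: measurable_maxr => //; exact: measurable_funS mh.
- by move=> x _; rewrite lee_fin le_max lexx orbT.
Qed.

(** By the Lebesgue density theorem almost every point of [A] has density 1. At a point of [A], the
    hole of radius [c * |s|] lies in the ball of radius [2 * |s|] because [c <= 1], and takes away
    the fraction [c / 2] of it, at arbitrarily small scales. *)
Lemma porous_lebesgue_null (R : realType) (A : set R) (c : R) :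
  measurable A -> 0 < c -> c <= 1 ->
  (forall x r, A x -> 0 < r -> exists s, [/\ 0 < `|s|, `|s| < r &
     forall y, `|y - (x + s)| < c * `|s| -> ~ A y]) ->
  (@lebesgue_measure R).-negligible A.
Proof.
move=> mA c0 c1 por.
have := lebesgue_density mA.
apply: negligibleS => x Ax /=; rewrite indicE mem_set//= => H.
have /fine_cvgP[fnum /cvgrPdist_lt /(_ (c / 2))] := H.
rewrite divr_gt0// => /(_ isT) /=.
rewrite near_withinE => -[e /= e0 He].
have e20 : 0 < e / 2 by rewrite divr_gt0.
have [s [s0 se hole]] := por x _ Ax e20.
pose r := 2 * `|s|.
have r0 : 0 < r by rewrite mulr_gt0.
have rr : ball 0 e r.
  by rewrite /ball /= sub0r normrN gtr0_norm// /r; lra.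
have := He _ rr r0.
rewrite lebesgue_measure_ball ?ltW//.
have mB : measurable (ball x r : set R) by exact: measurable_ball.
have mC : measurable (ball (x + s) (c * `|s|) : set R) by exact: measurable_ball.
have cs0 : 0 < c * `|s| by rewrite mulr_gt0.
have CB : ball (x + s) (c * `|s|) `<=` ball x r.
  move=> y /=; rewrite /ball /= => yc.
  rewrite (_ : x - y = (x + s - y) - s); last by ring.
  apply: (le_lt_trans (ler_normB _ _)).
  rewrite /r mulrDl mul1r ltrD2r (lt_le_trans yc)// ler_piMl//.
have le1 : (lebesgue_measure (A `&` ball x r) <= (r *+ 2 - (c * `|s|) *+ 2)%:E)%E.
  apply: (@le_trans _ _ (lebesgue_measure (ball x r `\` ball (x + s) (c * `|s|)))).
    apply: le_measure; rewrite ?inE; [exact: measurableI|exact: measurableD|].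
    move=> y [Ay yx]; split => // yc; apply: (hole y) => //.
    by rewrite distrC.
  rewrite measureD//; last by rewrite [X in (X < _)%E]lebesgue_measure_ball ?ltry// ltW.
  rewrite setIidr// [X in (X - _)%E](lebesgue_measure_ball _ (ltW r0)).
  by rewrite [X in (_ - X)%E](lebesgue_measure_ball _ (ltW cs0)) -EFinB lexx.
have ge0 : (0 <= lebesgue_measure (A `&` ball x r))%E by exact: measure_ge0.
move: le1 ge0; case: (lebesgue_measure (A `&` ball x r)) => [m| |]//.
rewrite !lee_fin => m1 m0.
rewrite inver mulrn_eq0/= gt_eqF// -EFinM /=.
have : m * (r *+ 2)^-1 <= 1 - c / 2.
  rewrite ler_pdivrMr; last by rewrite pmulrn_lgt0.
  by apply: (le_trans m1); rewrite /r; lra.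
move=> q; rewrite ltr_norml => /andP[_]; lra.
Qed.

(** * Null sets in R^n *)

Section MatrixNorm.
Context {R : realType} {m n : nat}.
Implicit Types x y : 'M[R]_(m, n).

Lemma coord_le_mx_norm x i j : `|x i j| <= `|x|.
Proof.
rewrite /Num.Def.normr /= mx_normrE.
exact: (le_bigmax _ (fun ij : 'I_m * 'I_n => `|x ij.1 ij.2|) (i, j)).
Qed.

Lemma coord_dist_le_mx_norm x y i j : `|x i j - y i j| <= `|x - y|.
Proof. by have := coord_le_mx_norm (x - y) i j; rewrite !mxE. Qed.

Lemma mx_norm_leP x (e : R) : 0 <= e ->
  `|x| <= e <-> forall i j, `|x i j| <= e.
Proof.
move=> e0; split=> [xe i j|H]; first exact: le_trans (coord_le_mx_norm x i j) xe.
rewrite /Num.Def.normr /= mx_normrE; apply: bigmax_le => // -[i j] _; exact: H.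
Qed.

Lemma mx_norm_ltP x (e : R) : 0 < e ->
  `|x| < e <-> forall i j, `|x i j| < e.
Proof.
move=> e0; split=> [xe i j|H]; first exact: le_lt_trans (coord_le_mx_norm x i j) xe.
rewrite /Num.Def.normr /= mx_normrE; apply: bigmax_lt => // -[i j] _; exact: H.
Qed.

End MatrixNorm.

Section CoordMeasurable.
Context {R : realType}.

(* Quantifying over all coordinatewise measurable maps into R^n avoids choosing a
   sigma-algebra on ['rV_n] and makes stability under affine maps immediate. *)
Definition coord_measurable n (A : set 'rV[R]_n) : Prop :=
  forall d (T : measurableType d) (X : T -> 'rV[R]_n),
    (forall i, measurable_fun setT (fun t => X t ord0 i)) ->
    measurable (X @^-1` A).

Definition null_on_lines n (i : 'I_n) (A : set 'rV[R]_n) : Prop :=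
  forall x, (@lebesgue_measure R).-negligible
    [set t | A (x + t *: delta_mx ord0 i)].

Lemma coord_measurableC n (A : set 'rV[R]_n) :
  coord_measurable A -> coord_measurable (~` A).
Proof.
by move=> mA d T X mX; rewrite preimage_setC; apply: measurableC; exact: mA.
Qed.

Lemma coord_measurableI n (A B : set 'rV[R]_n) :
  coord_measurable A -> coord_measurable B -> coord_measurable (A `&` B).
Proof.
by move=> mA mB d T X mX; rewrite preimage_setI; apply: measurableI; [exact: mA|exact: mB].
Qed.

Lemma coord_measurable_bigcup n (I : Type) (A : I -> set 'rV[R]_n) :
  countable [set: I] ->
  (forall i, coord_measurable (A i)) -> coord_measurable (\bigcup_i A i).
Proof.
move=> cI mA d T X mX; rewrite preimage_bigcup.
by apply: countable_bigcupT_measurable => // i; exact: mA.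
Qed.

Lemma coord_measurable_bigcap n (I : Type) (A : I -> set 'rV[R]_n) :
  countable [set: I] ->
  (forall i, coord_measurable (A i)) -> coord_measurable (\bigcap_i A i).
Proof.
move=> cI mA; rewrite -[X in coord_measurable X]setCK setC_bigcap.
apply: coord_measurableC; apply: coord_measurable_bigcup => // i.
exact/coord_measurableC.
Qed.

Lemma coord_measurable_ball n (c : 'rV[R]_n) (r : R) :
  coord_measurable (ball c r).
Proof.
have [r0|r0] := ltP 0 r; last first.
  have -> : ball c r = set0.
    apply/seteqP; split=> x //; rewrite -ball_normE /ball_ /=.
    by move=> /(le_lt_trans (normr_ge0 _)); rewrite ltNge r0.
  by move=> d T X mX; rewrite preimage_set0.
move=> d T X mX.
have -> : X @^-1` ball c r =
    \bigcap_(i : 'I_n) [set t | ball (c ord0 i) r (X t ord0 i)].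
  apply/seteqP; split => [t /= + i _|t /= H].
    rewrite -ball_normE /ball_ /= => /(mx_norm_ltP _ r0) /(_ ord0 i).
    by rewrite !mxE.
  rewrite -ball_normE /ball_ /=; apply/(mx_norm_ltP _ r0) => i j.
  by rewrite !mxE (ord1 i); exact: H.
rewrite -[X in measurable X]setCK setC_bigcap; apply: measurableC.
apply: countable_bigcupT_measurable; first exact: countableP.
move=> i; apply: measurableC.
rewrite -[X in measurable X]setTI; apply: (mX i) => //.
exact: measurable_ball.
Qed.

Lemma coord_measurable_open n (U : set 'rV[R]_n) : open U -> coord_measurable U.
Proof.
move=> oU.
pose c (p : 'rV[rat]_n) : 'rV[R]_n := \row_i ratr (p ord0 i).
pose B (p : 'rV[rat]_n * nat) := [set x | ball (c p.1) (p.2.+1%:R^-1) x /\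
   ball (c p.1) (p.2.+1%:R^-1) `<=` U].
suff -> : U = \bigcup_p B p.
  apply: coord_measurable_bigcup; first exact: countableP.
  move=> p; have [H|H] := pselect (ball (c p.1) (p.2.+1%:R^-1) `<=` U).
    have -> : B p = ball (c p.1) (p.2.+1%:R^-1).
      by apply/seteqP; split => x //= [].
    exact: coord_measurable_ball.
  have -> : B p = set0 by apply/seteqP; split => x //= [].
  by move=> d T X mX; rewrite preimage_set0.
apply/seteqP; split => [x Ux|x [p _ []]]; last by move=> xp; exact.
have /nbhs_ballP[e /= e0 xe] : nbhs x U by exact: open_nbhs_nbhs.
have [k kP] : exists k : nat, k.+1%:R^-1 < e / 2.
  have e20 : 0 < e / 2 by rewrite divr_gt0.
  near \oo => k; exists k; near: k; exact: (near_infty_natSinv_lt (PosNum e20)).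
have k0 : 0 < k.+1%:R^-1 :> R by rewrite invr_gt0.
have Hq i : exists q : rat, `|x ord0 i - ratr q| < k.+1%:R^-1.
  have [|q] := @rat_in_itvoo R (x ord0 i - k.+1%:R^-1) (x ord0 i + k.+1%:R^-1).
    by rewrite ltrD2l gtrN.
  by rewrite in_itv/= => /andP[q1 q2]; exists q; rewrite ltr_distlC q1 q2.
pose p : 'rV[rat]_n := \row_i projT1 (cid (Hq i)).
have xp : ball (c p) (k.+1%:R^-1) x.
  rewrite -ball_normE /ball_ /=; apply/(mx_norm_ltP _ k0) => i j.
  by rewrite !mxE (ord1 i) distrC; case: (cid (Hq j)).
exists (p, k) => //; split => //= y yp; apply: xe.
apply: (@le_ball _ _ _ (k.+1%:R^-1 + k.+1%:R^-1)); first by rewrite (splitr e) lerD // ltW.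
by apply: ball_triangle yp; exact: ball_sym.
Unshelve. all: by end_near. Qed.

Lemma coord_measurable_closed n (F : set 'rV[R]_n) : closed F -> coord_measurable F.
Proof.
move=> cF; rewrite -[F]setCK; apply/coord_measurableC/coord_measurable_open.
by rewrite openC.
Qed.

End CoordMeasurable.

Section ProductNull.
Context d1 d2 (T1 : measurableType d1) (T2 : measurableType d2) (R : realType).
Variable m1 : {sigma_finite_measure set T1 -> \bar R}.
Variable m2 : {sigma_finite_measure set T2 -> \bar R}.
Local Open Scope ereal_scope.

Lemma product_null_xsection (B : set (T1 * T2)) :
  (forall x, m2 (xsection B x) = 0) -> (m1 \x m2) B = 0.
Proof. by move=> H; rewrite /product_measure1 integral0_eq// => x _; exact: H. Qed.

Lemma product_null_ysection (B : set (T1 * T2)) : measurable B ->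
  (forall y, m1 (ysection B y) = 0) -> (m1 \x m2) B = 0.
Proof.
move=> mB H.
(* The product measure is defined by integrating x-sections; uniqueness identifies it with the one
   obtained from y-sections. *)
rewrite (@product_measure_unique _ _ _ _ _ m1 m2 (m1 \x^ m2)%E)//=; last first.
  by move=> A1 A2 mA1 mA2; rewrite product_measure2E.
by rewrite /product_measure2 integral0_eq// => x _; exact: H.
Qed.

(** The product measure of [B] is 0 by y-sections, and it is also the integral of the nonnegative
    function [m2 (xsection B x)], which therefore vanishes almost everywhere. *)
Lemma ae_null_xsection (B : set (T1 * T2)) : measurable B ->
  (forall y, m1 (ysection B y) = 0) ->
  {ae m1, forall x, m2 (xsection B x) = 0}.
Proof.
move=> mB /(product_null_ysection mB) B0.
have mf : measurable_fun setT (m2 \o xsection B) by exact: measurable_fun_xsection.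
have : \int[m1]_(x in setT) `|(m2 \o xsection B) x| = 0.
  by under eq_integral do rewrite gee0_abs//=.
move/(ae_eq_integral_abs _ measurableT mf).
by apply: (@filterS _ _ (ae_filter_ringOfSetsType m1)) => x /(_ Logic.I).
Qed.

End ProductNull.

Section RandomVector.
Context {R : realType}.

Let prepend_coord n (a : R) (y : 'rV[R]_n) : 'rV[R]_(1 + n) :=
  row_mx a%:M y.

Lemma measurable_prepend n d (T : measurableType d) (a : T -> R)
    (X : T -> 'rV[R]_n) :
  measurable_fun setT a ->
  (forall i, measurable_fun setT (fun t => X t ord0 i)) ->
  forall i, measurable_fun setT (fun t => prepend_coord (a t) (X t) ord0 i).
Proof.
move=> ma mX i; rewrite /prepend_coord -[i]fintype.splitK; case: (fintype.split i) => j /=.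
  under eq_fun do rewrite row_mxEl mxE (ord1 j) eqxx mulr1n.
  exact: ma.
by under eq_fun do rewrite row_mxEr; exact: mX.
Qed.

(* The law of [X] stands in for n-dimensional Lebesgue measure, of which only
   this consequence of Fubini's theorem is needed. *)
Lemma exists_random_vector n :
  exists d (T : measurableType d) (P : probability T R) (X : T -> 'rV[R]_n),
  (forall i, measurable_fun setT (fun t => X t ord0 i)) /\
  (forall i (A : set 'rV[R]_n), coord_measurable A -> null_on_lines i A ->
        P (X @^-1` A) = 0%E).
Proof.
elim: n => [|n [d [T [P [X [mX nX]]]]]].
  exists default_measure_display, unit, (\d_tt), (fun=> 0); split => //.
  by move=> [].
(* The coordinates are independent and uniform on [0, 1]; the uniform law is dominated by Lebesgue
   measure, so null lines are null for it. *)
pose U : probability (measurableTypeR R) R := uniform_prob (@ltr01 R).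
pose P' := (U \x P)%E.
pose X' (p : measurableTypeR R * T) := prepend_coord p.1 (X p.2).
have mX' : forall i, measurable_fun setT (fun t => X' t ord0 i).
  apply: measurable_prepend; first exact: measurable_fst.
  by move=> i; apply: (measurableT_comp (mX i)); exact: measurable_snd.
exists _, _, P', X'; split => //.
have lineE (a t : R) (y e : 'rV[R]_n) b : 
    prepend_coord a y + t *: prepend_coord b e = prepend_coord (a + t * b) (y + t *: e).
  by rewrite /prepend_coord scale_row_mx add_row_mx scale_scalar_mx -raddfD.
have d0E : delta_mx ord0 (lshift n ord0) = prepend_coord 1 0 :> 'rV[R]_(1 + n).
  apply/rowP => k; rewrite -[k]fintype.splitK; case: (fintype.split k) => j /=; rewrite /prepend_coord mxE eqxx /=.
    by rewrite row_mxEl mxE (ord1 j) eqxx.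
  by rewrite row_mxEr mxE.
have dSE j : delta_mx ord0 (rshift 1 j) = prepend_coord 0 (delta_mx ord0 j) :> 'rV[R]_(1 + n).
  apply/rowP => k; rewrite -[k]fintype.splitK; case: (fintype.split k) => l /=; rewrite /prepend_coord mxE eqxx /=.
    by rewrite row_mxEl mxE mul0rn eq_lrshift.
  by rewrite row_mxEr mxE eq_rshift.
move=> i A mA nA.
have mXA : measurable (X' @^-1` A) by exact: mA.
(* In the new direction the sections at fixed [t] are parts of lines. In an old direction the
   section at a fixed first coordinate falls under the induction hypothesis. *)
move: nA; rewrite -[i](@fintype.splitK 1 n); case: (fintype.split _) => j /= nA.
  apply: product_null_ysection => // t.
  rewrite (ord1 j) in nA.
  have := nA (prepend_coord 0 (X t)).
  rewrite (_ : [set _ | _] = ysection (X' @^-1` A) t); last first.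
    apply/seteqP; split => a /=; rewrite ?ysectionE /ysection /= ?inE /X' /= d0E lineE;
    by rewrite add0r mulr1 scaler0 addr0.
  have mY := measurable_ysection t mXA.
  move/(measure_negligible mY) => Y0.
  have /null_content_dominatesP := @dominates_uniform_prob R 0 1 ltr01.
  by apply.
apply: product_null_xsection => a.
rewrite (_ : xsection _ _ = X @^-1` [set y | A (prepend_coord a y)]); last first.
  by apply/seteqP; split => t /=; rewrite /xsection /= inE.
apply: (nX j).
  move=> d0 T0 X0 mX0; apply: (mA _ _ (fun t => prepend_coord a (X0 t))).
  by apply: measurable_prepend.
move=> y; have := nA (prepend_coord a y).
under eq_set do rewrite dSE lineE mulr0 addr0.
exact.
Qed.

End RandomVector.

(** * Rademacher's theorem *)

Section DiffEps.
Context {R : realType} {V W : normedModType R}.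
Implicit Types (f : V -> W) (x : V).

Lemma is_diff_eps f x (df : {linear V -> W}) : continuous df ->
  (forall e : R, 0 < e -> exists2 d : R, 0 < d &
     forall h, `|h| < d -> `|f (x + h) - f x - df h| <= e * `|h|) ->
  differentiable f x /\ 'd f x = df :> (V -> W).
Proof.
move=> cdf H.
have E : f \o shift x = cst (f x) + df +o_ (0 : V) id.
  apply/eqaddoP => e e0; have [d d0 Hd] := H e e0.
  near=> h; rewrite !fctE /= opprD addrA addrC [h + x]addrC addrC.
  apply: Hd; near: h; exact: nbhs0_lt.
have dE := diff_unique cdf E.
split => //; apply/diff_locallyP; split; first by rewrite dE.
by rewrite dE.
Unshelve. all: by end_near. Qed.

Lemma differentiable_eps f x : differentiable f x ->
  forall e : R, 0 < e -> exists2 d : R, 0 < d &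
     forall h, `|h| < d -> `|f (x + h) - f x - 'd f x h| <= e * `|h|.
Proof.
move=> /diff_locally /eqaddoP H e e0.
have /nbhs_ballP[d /= d0 Hd] := H e e0.
exists d => // h hd.
have /= := Hd h; rewrite !fctE /= opprD addrA [h + x]addrC; apply.
by rewrite -ball_normE /ball_ /= sub0r normrN.
Qed.

End DiffEps.

Section Dotv.
Context {R : realType} {n : nat}.
Implicit Types u v : 'rV[R]_n.

Lemma dotv_is_linear u : linear (dotv u).
Proof.
move=> k v w; rewrite /dotv scaler_sumr -big_split; apply: eq_bigr => i _ /=.
by rewrite !mxE mulrDr mulrCA.
Qed.

Definition dotl u : {linear 'rV[R]_n -> R} :=
  HB.pack (dotv u) (GRing.isLinear.Build R 'rV[R]_n R _ (dotv u) (dotv_is_linear u)).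

Lemma dotv0 u : dotv u 0 = 0.
Proof. exact: (linear0 (dotl u)). Qed.

Lemma dotvDr u v w : dotv u (v + w) = dotv u v + dotv u w.
Proof. exact: (linearD (dotl u)). Qed.

Lemma dotvC u v : dotv u v = dotv v u.
Proof. by apply: eq_bigr => i _; rewrite mulrC. Qed.

Lemma dotvZr k u v : dotv u (k *: v) = k * dotv u v.
Proof.
by rewrite /dotv mulr_sumr; apply: eq_bigr => i _; rewrite !mxE mulrCA.
Qed.

Lemma dotvBr u v w : dotv u (v - w) = dotv u v - dotv u w.
Proof. exact: (linearB (dotl u)). Qed.

Lemma dotvBl u v w : dotv (u - v) w = dotv u w - dotv v w.
Proof. by rewrite ![dotv _ w]dotvC dotvBr. Qed.

Lemma dotv_bound u v : `|dotv u v| <= (\sum_(i < n) `|u ord0 i|) * `|v|.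
Proof.
rewrite /dotv mulr_suml; apply: (le_trans (ler_norm_sum _ _ _)).
apply: ler_sum => i _; rewrite normrM ler_wpM2l//; exact: coord_le_mx_norm.
Qed.

Lemma dotl_continuous u : continuous (dotl u).
Proof.
apply: bounded_linear_continuous; apply/linear_boundedP.
near=> r => v /=; apply: (le_trans (dotv_bound u v)); rewrite ler_wpM2r//.
Unshelve. all: by end_near. Qed.

End Dotv.

Lemma lipschitz_continuous (R : realType) (V W : normedModType R) (phi : V -> W) (L : R) :
  (forall x y, `|phi x - phi y| <= L * `|x - y|) -> continuous phi.
Proof.
move=> philip x; apply/(@cvgrPdist_le _ _ _ (nbhs x)) => e e0.
have L1 : 0 < `|L| + 1 by rewrite ltr_wpDl.
apply/nbhs_ballP; exists (e / (`|L| + 1)); first by rewrite /= divr_gt0.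
move=> y; rewrite -ball_normE /ball_ /= ltr_pdivlMr// mulrC => /ltW xy.
apply: le_trans xy; apply: (le_trans (philip x y)).
by rewrite ler_wpM2r// (le_trans (ler_norm _))// lerDl.
Qed.

Section Rademacher.
Context {R : realType} {n : nat} (phi : 'rV[R]_n -> R) (L : R).
Hypothesis philip : forall x y, `|phi x - phi y| <= L * `|x - y|.

Let evec (i : 'I_n) : 'rV[R]_n := delta_mx ord0 i.

Definition lin_err (a x h : 'rV[R]_n) : R := phi (x + h) - phi x - dotv a h.

Definition approx_on (W : set 'rV[R]_n) (a : 'rV[R]_n) (e d : R) :
    set 'rV[R]_n :=
  [set x | forall h, W h -> `|h| < d -> `|lin_err a x h| <= e * `|h|].

(** For fixed [h] the error is a Lipschitz function of the base point, so each condition on [x] is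
    closed. This is the source of the measurability of all exceptional sets below. *)
Lemma approx_on_closed W a e d : closed (approx_on W a e d).
Proof.
have -> : approx_on W a e d = \bigcap_(h in [set h | W h /\ `|h| < d])
    [set x | `|lin_err a x h| <= e * `|h|].
  apply/seteqP; split => x /=; first by move=> H h [Wh hd]; exact: H.
  by move=> H h Wh hd; exact: (H h (conj Wh hd)).
apply: closed_bigI => h _.
have cf : continuous (fun x => `|lin_err a x h|).
  apply: (@lipschitz_continuous _ _ _ _ (2 * L)) => x y.
  apply: (le_trans (ler_dist_dist _ _)).
  rewrite (_ : _ - _ = (phi (x + h) - phi (y + h)) - (phi x - phi y)); last first.
    by rewrite /lin_err; ring.
  apply: (le_trans (ler_normB _ _)).
  have := philip (x + h) (y + h); rewrite opprD addrACA subrr addr0.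
  by have := philip x y; lra.
by apply: (preimage_closed _ (@closed_le R (e * `|h|))) => x _; exact: cf.
Qed.

Definition ratv (p : 'rV[rat]_n) : 'rV[R]_n := \row_i ratr (p ord0 i).

(** The span of the first [j] coordinate vectors. *)
Definition flat (j : nat) : set 'rV[R]_n :=
  [set h | forall i : 'I_n, (j <= i)%N -> h ord0 i = 0].

Definition inv_nat (k : nat) : R := k.+1%:R^-1.

(** Rational slopes and reciprocal integers keep all unions countable. The slope may depend on the
    tolerance; convergence of the slopes is proved only once [j] has reached [n]. *)
Definition differentiable_along (j : nat) (x : 'rV[R]_n) : Prop :=
  forall k, exists a m, approx_on (flat j) (ratv a) (inv_nat k) (inv_nat m) x.

Definition line_cross (j : 'I_n) : set 'rV[R]_n :=
  [set h | flat j h \/ exists t, h = t *: evec j].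

(** The factor 3 is the error budget in the hole argument: two linear errors of one tolerance each,
    and two Lipschitz errors that together cost one more. *)
Definition porous_part (j : 'I_n) (p : 'rV[rat]_n * nat * nat) :=
  approx_on (line_cross j) (ratv p.1.1) (inv_nat p.1.2) (inv_nat p.2) `&`
  ~` \bigcup_m approx_on (flat j.+1) (ratv p.1.1) (3 * inv_nat p.1.2) (inv_nat m).

Definition has_partial (j : 'I_n) : set 'rV[R]_n :=
  \bigcap_k \bigcup_(p : 'rV[rat]_n * nat)
    approx_on [set h | exists t, h = t *: evec j] (ratv p.1) (inv_nat k) (inv_nat p.2).

Definition bad_set (j : 'I_n) : set 'rV[R]_n :=
  ~` has_partial j `|` \bigcup_p porous_part j p.

Lemma inv_nat_gt0 k : 0 < inv_nat k.
Proof. by rewrite invr_gt0. Qed.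

Lemma inv_nat_lt e : 0 < e -> exists k, inv_nat k < e.
Proof.
move=> e0; near \oo => k; exists k; near: k.
exact: (near_infty_natSinv_lt (PosNum e0)).
Unshelve. all: by end_near. Qed.

Lemma coord_measurable_approx W a e d : coord_measurable (approx_on W a e d).
Proof. exact/coord_measurable_closed/approx_on_closed. Qed.

Lemma coord_measurable_porous j p : coord_measurable (porous_part j p).
Proof.
apply: coord_measurableI; first exact: coord_measurable_approx.
apply/coord_measurableC/coord_measurable_bigcup; first exact: countableP.
by move=> i; exact: coord_measurable_approx.
Qed.

Lemma coord_measurableU (A B : set 'rV[R]_n) :
  coord_measurable A -> coord_measurable B -> coord_measurable (A `|` B).
Proof.
by move=> mA mB d T X mX; rewrite preimage_setU; apply: measurableU; [exact: mA|exact: mB].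
Qed.

Lemma coord_measurable_bad j : coord_measurable (bad_set j).
Proof.
apply: coord_measurableU; last first.
  by apply: coord_measurable_bigcup => [|p]; [exact: countableP|exact: coord_measurable_porous].
apply/coord_measurableC/coord_measurable_bigcap => [|k]; first exact: countableP.
by apply: coord_measurable_bigcup => [|p]; [exact: countableP|exact: coord_measurable_approx].
Qed.

Lemma evec_norm j (t : R) : `|t *: evec j| = `|t|.
Proof.
apply/eqP; rewrite eq_le; apply/andP; split.
  apply/mx_norm_leP => // i k; rewrite !mxE.
  by case: (_ && _); rewrite ?mulr1 ?mulr0 ?normr0.
have := coord_le_mx_norm (t *: evec j) ord0 j.
by rewrite !mxE !eqxx mulr1.
Qed.

Lemma lin_err_split (j : 'I_n) a x y h :
  lin_err a x h = (phi (x + h) - phi (y + (h - h ord0 j *: evec j)))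
    + lin_err a y (h - h ord0 j *: evec j)
    + (phi y - phi (x + h ord0 j *: evec j)) + lin_err a x (h ord0 j *: evec j).
Proof.
have -> : lin_err a x h = phi (x + h) - phi x
    - (dotv a (h - h ord0 j *: evec j) + dotv a (h ord0 j *: evec j)).
  by rewrite -(linearD (dotl a)) subrK.
rewrite /lin_err; ring.
Qed.

(* At a point of [porous_part j p] some [h] has a large error; inserting a
   nearby point [y] of the same set close to [x + h_j e_j] would make all four
   terms of [lin_err_split] small, so no such [y] exists. *)
Lemma porous_part_hole (j : 'I_n) p : 0 <= L ->
  exists c : R, [/\ 0 < c, c <= 1 & forall x r, porous_part j p x -> 0 < r ->
    exists t, [/\ 0 < `|t|, `|t| < r &
      forall y, `|y - (x + t *: evec j)| < c * `|t| -> ~ porous_part j p y]].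
Proof.
move=> L0; set a := ratv p.1.1; set e := inv_nat p.1.2; set d := inv_nat p.2.
have e0 : 0 < e by exact: inv_nat_gt0.
have L20 : 0 < 2 * L + 1 by rewrite ltr_wpDl// mulr_ge0.
have q0 : 0 < e / (2 * L + 1) by rewrite divr_gt0.
(* With this hole radius the two Lipschitz terms together are at most [2 * L / (2 * L + 1)] times
   [e * |h|]. *)
exists (Num.min 1 (e / (2 * L + 1))); split.
- by rewrite lt_min ltr01.
- by rewrite ge_min lexx.
move=> x r [Ax Bx] r0.
have [m mr] : exists m, inv_nat m < Num.min r d.
  by apply: inv_nat_lt; rewrite lt_min r0 inv_nat_gt0.
have [h [hflat hm herr]] : exists h, [/\ flat j.+1 h, `|h| < inv_nat m &
    3 * e * `|h| < `|lin_err a x h|].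
  apply: contrapT => H; apply: Bx; exists m => //= h hf hm.
  by rewrite leNgt; apply/negP => h3; apply: H; exists h.
set t := h ord0 j; set h' := h - t *: evec j.
have th : `|t| <= `|h| by exact: coord_le_mx_norm.
have h'h : `|h'| <= `|h|.
  apply/mx_norm_leP => // i k; rewrite (ord1 i) /h' !mxE eqxx /=.
  have [->|kj] := eqVneq k j; first by rewrite mulr1 subrr normr0.
  by rewrite mulr0 subr0 coord_le_mx_norm.
have h'flat : flat j h'.
  move=> i ji; rewrite /h' !mxE eqxx /=.
  have [->|ij] := eqVneq i j; first by rewrite mulr1 subrr.
  by rewrite mulr0 subr0; apply: hflat; rewrite ltn_neqAle ji andbT eq_sym.
move: mr; rewrite lt_min => /andP[mr md].
have hd : `|h| < d by exact: lt_trans md.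
(* If [t = 0], then [h] lies in [flat j], where the error is at most [e * |h|], against the choice
   of [h]. *)
have t0 : t != 0.
  apply/negP => /eqP t0.
  have hh : h' = h by rewrite /h' t0 scale0r subr0.
  have := Ax h (or_introl _); rewrite -{1}hh => /(_ h'flat hd).
  rewrite leNgt => /negP; apply; apply: le_lt_trans herr.
  by rewrite ler_wpM2r// ler_peMl ?ltW//; lra.
exists t; split; first by rewrite normr_gt0.
- exact: le_lt_trans th (lt_trans hm mr).
move=> y yt [Ay _].
have yh : `|y - (x + t *: evec j)| <= (e / (2 * L + 1)) * `|h|.
  apply: (le_trans (ltW yt)); apply: ler_pM => //; last by rewrite ge_min lexx orbT.
  by rewrite le_min ler01 ltW.
move: herr; rewrite (lin_err_split j _ _ y) -/t -/h'.
rewrite ltNge => /negP; apply.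
have H1 : `|phi (x + h) - phi (y + h')| <= L * ((e / (2 * L + 1)) * `|h|).
  apply: (le_trans (philip _ _)); rewrite ler_wpM2l//.
  rewrite (_ : _ - _ = - (y - (x + t *: evec j))) ?normrN//.
  by rewrite /h'; apply/rowP => i; rewrite !mxE; ring.
have H3 : `|phi y - phi (x + t *: evec j)| <= L * ((e / (2 * L + 1)) * `|h|).
  by apply: (le_trans (philip _ _)); rewrite ler_wpM2l.
have H2 : `|lin_err a y h'| <= e * `|h|.
  apply: (@le_trans _ _ (e * `|h'|)); last by rewrite ler_wpM2l// ltW.
  by apply: Ay; [left|exact: le_lt_trans hd].
have H4 : `|lin_err a x (t *: evec j)| <= e * `|h|.
  apply: (@le_trans _ _ (e * `|t|)); last by rewrite ler_wpM2l// ltW.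
  rewrite -[`|t|](evec_norm j); apply: Ax; first by right; exists t.
  by rewrite evec_norm; exact: le_lt_trans hd.
have LL : L * ((e / (2 * L + 1)) * `|h|) * 2 <= e * `|h|.
  have -> : L * ((e / (2 * L + 1)) * `|h|) * 2 = (e * `|h|) * (2 * L / (2 * L + 1)).
    by field; exact: lt0r_neq0.
  apply: ler_piMr; first by rewrite mulr_ge0// ltW.
  by rewrite ler_pdivrMr// mul1r lerDl.
apply: (@le_trans _ _ (L * ((e / (2 * L + 1)) * `|h|) + e * `|h| +
  L * ((e / (2 * L + 1)) * `|h|) + e * `|h|)); last by lra.
by do 3 (apply: (le_trans (ler_normD _ _)); apply: lerD => //).
Qed.

Lemma measurable_line_coord (x : 'rV[R]_n) j i :
  measurable_fun setT (fun t : measurableTypeR R => (x + t *: evec j) ord0 i).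
Proof.
under eq_fun do rewrite !mxE.
apply: measurable_funD => //; apply: measurable_funM => //.
Qed.

Lemma negligible_countable_bigcup (I : countType) (F : I -> set (measurableTypeR R)) :
  (forall i, (@lebesgue_measure R).-negligible (F i)) ->
  (@lebesgue_measure R).-negligible (\bigcup_i F i).
Proof.
move=> nF; pose G k := if @unpickle I k is Some i then F i else set0.
have : (@lebesgue_measure R).-negligible (\bigcup_k G k).
  apply: negligible_bigcup => k; rewrite /G; case: unpickle => [i|]; first exact: nF.
  exact: negligible_set0.
apply: negligibleS => t [i _ Fit]; exists (pickle i) => //.
by rewrite /G pickleK.
Qed.

Lemma dotv_evec (a : 'rV[R]_n) j t : dotv a (t *: evec j) = t * a ord0 j.
Proof.
rewrite /dotv (bigD1 j)//= big1 ?addr0 => [|i ij].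
  by rewrite !mxE !eqxx mulr1 mulrC.
by rewrite !mxE eqxx (negbTE ij) !mulr0.
Qed.

Lemma rat_approx (y e : R) : 0 < e -> exists q : rat, `|y - ratr q| < e.
Proof.
move=> e0; have [|q] := @rat_in_itvoo R (y - e) (y + e).
  by rewrite ltrD2l gtrN.
by rewrite in_itv/= => /andP[q1 q2]; exists q; rewrite ltr_distlC q1 q2.
Qed.

Lemma derivable_has_partial x j t :
  derivable (fun s : R => phi (x + s *: evec j)) t 1 ->
  has_partial j (x + t *: evec j).
Proof.
move=> /derivable1_diffP dg k _.
set g := (fun s : R => _) in dg.
have e0 : 0 < inv_nat k / 2 by rewrite divr_gt0// inv_nat_gt0.
have [d d0 Hd] := differentiable_eps dg e0.
have [m md] := inv_nat_lt d0.
have [q qP] := rat_approx ('d g t 1) e0.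
(* On this line only the [j]-th entry of the slope is seen, so a constant row serves. Half of the
   tolerance pays for rounding the derivative to a rational. *)
exists (const_mx q, m) => // _ [s ->]; rewrite evec_norm => sm.
rewrite /lin_err dotv_evec !mxE.
have := Hd s (lt_trans sm md).
have -> : 'd g t s = s * 'd g t 1.
  by rewrite -[X in 'd g t X]mulr1 -[s * 1]/(s *: (1 : R)) linearZ.
rewrite /g scalerDl addrA => H.
rewrite (_ : _ - _ = (phi (x + t *: evec j + s *: evec j) - phi (x + t *: evec j)
   - s * 'd g t 1) + s * ('d g t 1 - ratr q)); last by ring.
apply: (le_trans (ler_normD _ _)); rewrite normrM.
have : `|s| * `|'d g t 1 - ratr q| <= `|s| * (inv_nat k / 2).
  by rewrite ler_wpM2l// ltW.
move: H; rewrite /g; lra.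
Qed.

Hypothesis L0 : 0 <= L.

Lemma bad_set_null j : null_on_lines j (bad_set j).
Proof.
move=> x.
rewrite (_ : [set _ | _] = [set t | ~ has_partial j (x + t *: evec j)] `|`
   \bigcup_p [set t | porous_part j p (x + t *: evec j)]); last first.
  by apply/seteqP; split => t.
apply: negligibleU.
  have : {ae (@lebesgue_measure R), forall t, derivable (fun s : R => phi (x + s *: evec j)) t 1}.
    apply: (@lipschitz_ae_derivable _ _ L) => s t; apply: (le_trans (philip _ _)).
    by rewrite opprD addrACA subrr add0r -scalerBl evec_norm.
  by apply: negligibleS => t /= nh dt; apply: nh; exact: derivable_has_partial.
apply: negligible_countable_bigcup => p.
have [c [c0 c1 hole]] := porous_part_hole j p L0.
apply: (@porous_lebesgue_null _ _ c) => //.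
  have := @coord_measurable_porous j p _ (measurableTypeR R) (fun t => x + t *: evec j).
  by apply => i; exact: measurable_line_coord.
move=> t r At r0; have [s [s0 sr Hs]] := hole _ _ At r0.
exists s; split => // y ys; apply: Hs.
rewrite (_ : _ - _ = (y - (t + s)) *: evec j) ?evec_norm//.
by apply/rowP => i; rewrite !mxE; ring.
Qed.

Lemma inv_nat_le k l : (k <= l)%N -> inv_nat l <= inv_nat k.
Proof. by move=> kl; rewrite /inv_nat lef_pV2 ?posrE// ler_nat ltnS. Qed.

(** A slope good on [flat j] and one good on the [j]-th line merge into a slope [b] good on
    [line_cross j]. As [x] avoids the porous part indexed by [b], the slope [b] is good on the sum
    of the two subspaces, at three times the tolerance. *)
Lemma differentiable_alongS (j : 'I_n) x : ~ bad_set j x ->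
  differentiable_along j x -> differentiable_along j.+1 x.
Proof.
move=> /not_orP[/contrapT hp np] da K.
(* Chosen so that [k + 1 = 3 * (K + 1)], which compensates the factor 3 exactly. *)
pose k := (3 * K + 2)%N.
have kK : 3 * inv_nat k = inv_nat K.
  rewrite /inv_nat /k (_ : (3 * K + 2).+1 = (3 * K.+1)%N); last by rewrite mulnS -addnS addnC.
  by rewrite natrM invfM mulrA divff ?mul1r// pnatr_eq0.
have [a [m1 Ha]] := da k.
have [[q m2] _ /= Hq] := hp k Logic.I.
pose b : 'rV[rat]_n := \row_i (if i == j then q ord0 j else a ord0 i).
pose m := maxn m1 m2.
have Hb : approx_on (line_cross j) (ratv b) (inv_nat k) (inv_nat m) x.
  move=> h [hj|[t ->]] hm.
    have -> : lin_err (ratv b) x h = lin_err (ratv a) x h.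
      rewrite /lin_err; congr (_ - _); apply: eq_bigr => i _; rewrite !mxE.
      by have [->|//] := eqVneq i j; rewrite (hj j (leqnn _)) !mulr0.
    by apply: Ha => //; apply: lt_le_trans hm _; apply: inv_nat_le; exact: leq_maxl.
  have -> : lin_err (ratv b) x (t *: evec j) = lin_err (ratv q) x (t *: evec j).
    by rewrite /lin_err !dotv_evec !mxE eqxx.
  apply: Hq; first by exists t.
  by apply: lt_le_trans hm _; apply: inv_nat_le; exact: leq_maxr.
have [m' Hm'] : exists m', approx_on (flat j.+1) (ratv b) (inv_nat K) (inv_nat m') x.
  apply: contrapT => H; apply: np; exists (b, k, m) => //; split => //=.
  by rewrite kK => -[m' _ Hm']; apply: H; exists m'.
by exists b, m'.
Qed.

Lemma differentiable_of_good x : (forall j, ~ bad_set j x) -> differentiable phi x.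
Proof.
move=> good.
have da j : (j <= n)%N -> differentiable_along j x.
  elim: j => [_ k|j IH jn].
    exists 0, 0%N => h hf _; have -> : h = 0 by apply/rowP => i; rewrite hf ?mxE.
    by rewrite /lin_err addr0 subrr dotv0 subrr !normr0 mulr0.
  by apply: (@differentiable_alongS (Ordinal jn)) => //; exact/IH/ltnW.
have /choice[A HA] : forall k, exists a : 'rV[R]_n, exists2 d, 0 < d &
     approx_on setT a (inv_nat k) d x.
  move=> k; have [a [m H]] := da n (leqnn n) k.
  exists (ratv a), (inv_nat m); first exact: inv_nat_gt0.
  by move=> h _; apply: H => i; rewrite leqNgt ltn_ord.
(* Two slopes that approximate the same increment along a short multiple of [evec i] differ in their
   [i]-th entry by at most the sum of their tolerances. *)
have Acauchy k l i : `|A k ord0 i - A l ord0 i| <= inv_nat k + inv_nat l.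
  have [d1 d10 H1] := HA k; have [d2 d20 H2] := HA l.
  pose s := Num.min d1 d2 / 2.
  have s0 : 0 < s by rewrite divr_gt0// lt_min d10.
  have sm : s < Num.min d1 d2 by rewrite ltr_pdivrMr// ltr_pMr ?lt_min ?d10 ?ltr1n.
  have [s1 s2] : s < d1 /\ s < d2 by move: sm; rewrite lt_min => /andP[].
  have := H1 (s *: evec i) Logic.I; have := H2 (s *: evec i) Logic.I.
  rewrite evec_norm gtr0_norm// => /(_ s2) h2 /(_ s1) h1.
  have : `|lin_err (A l) x (s *: evec i) - lin_err (A k) x (s *: evec i)|
      <= inv_nat l * s + inv_nat k * s by rewrite (le_trans (ler_normB _ _))// lerD.
  rewrite /lin_err !dotv_evec (_ : _ - _ = s * (A k ord0 i - A l ord0 i)); last by ring.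
  by rewrite normrM gtr0_norm// => H; rewrite -(ler_pM2l s0); lra.
have Alim i : exists l : R, forall k, `|A k ord0 i - l| <= 2 * inv_nat k.
  have : cvgn (fun k => A k ord0 i).
    apply: cauchy_cvg; apply: cauchy_exP => e e0.
    have [K eK] := inv_nat_lt (divr_gt0 e0 (ltr0n _ 2)).
    exists (A K ord0 i); exists K => // k /= Kk.
    rewrite -ball_normE /ball_ /=; apply: (le_lt_trans (Acauchy _ _ _)).
    by rewrite (splitr e) ltr_leD// (le_trans (inv_nat_le Kk))// ltW.
  move=> /cvg_ex[l Al]; exists l => k; apply/ler_addgt0Pr => e e0.
  have [N _ HN] := (@cvgrPdist_lt _ _ _ _ _ _ _).1 Al e e0.
  pose N' := maxn N k.
  have := HN N' (leq_maxl _ _); rewrite /= distrC => h1.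
  have h2 := Acauchy k N' i; have h3 := inv_nat_le (leq_maxr N k).
  rewrite (_ : _ - l = (A k ord0 i - A N' ord0 i) + (A N' ord0 i - l)); last by ring.
  by apply: (le_trans (ler_normD _ _)); move: h3; rewrite -/N'; lra.
have [lim Hlim] := choice Alim.
pose a : 'rV[R]_n := \row_i lim i.
apply: (proj1 (is_diff_eps (df := dotl a) _ _)); first exact: dotl_continuous.
move=> e e0.
have n0 : 0 < 2 * n%:R + 1 :> R by rewrite ltr_wpDl// mulr_ge0.
(* The slope [A k] contributes one tolerance, and replacing it by the limit contributes two per
   coordinate, hence the divisor [2 * n + 1]. *)
have [k ke] := inv_nat_lt (divr_gt0 e0 n0).
have [d d0 Hd] := HA k; exists d => // h hd.
rewrite (_ : _ - _ = lin_err (A k) x h + dotv (A k - a) h); last first.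
  by rewrite /lin_err dotvBl -[dotl a h]/(dotv a h); ring.
apply: (le_trans (ler_normD _ _)).
have := Hd h Logic.I hd.
have : `|dotv (A k - a) h| <= (2 * n%:R * inv_nat k) * `|h|.
  apply: (le_trans (dotv_bound _ _)); rewrite ler_wpM2r//.
  apply: (@le_trans _ _ (\sum_(i < n) 2 * inv_nat k)).
    by apply: ler_sum => i _; rewrite !mxE.
  by rewrite sumr_const card_ord -mulr_natl; lra.
have : (2 * n%:R + 1) * inv_nat k * `|h| <= e * `|h|.
  by rewrite ler_wpM2r// mulrC -ler_pdivlMr// ltW.
by lra.
Qed.

(** The exceptional set is kept as one piece per coordinate direction, each null on every line of
    its own direction: the form to which [exists_random_vector] applies. *)
Theorem rademacher : exists N : 'I_n -> set 'rV[R]_n,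
  (forall i, coord_measurable (N i) /\ null_on_lines i (N i)) /\
  forall x, (forall i, ~ N i x) -> differentiable phi x.
Proof.
exists bad_set; split => [i|x]; last exact: differentiable_of_good.
by split; [exact: coord_measurable_bad|exact: bad_set_null].
Qed.

End Rademacher.

(** Meant for the rescaled random vector: when its argument moves along a line, the point moves at
    speed [inv_nat m]. *)
Lemma negligible_dilation (R : realType) (c : R) (A : set (measurableTypeR R)) :
  0 < c -> (@lebesgue_measure R).-negligible A ->
  (@lebesgue_measure R).-negligible [set s | A (c * s)].
Proof.
move=> c0 [N [mN N0 AN]].
pose g : measurableTypeR R -> measurableTypeR R := fun s => c * s.
have mg : measurable_fun setT g by apply: measurable_funM.
exists (g @^-1` N); split; last by move=> s /= /AN.
  by rewrite -[X in measurable X]setTI; exact: mg.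
pose m := mscale (NngNum (ltW c0)) (pushforward (@lebesgue_measure R) g).
have mE B : m mg B = (c%:E * lebesgue_measure (g @^-1` B))%E by [].
have E : forall B, measurable B -> lebesgue_measure B = m mg B.
  apply: lebesgue_measure_unique => X /ocitvP[->|[[a b] /= ab ->]].
    by rewrite !measure0.
  rewrite [RHS]mE (_ : g @^-1` _ = `](a / c), (b / c)]%classic); last first.
    apply/seteqP; split => s /=; rewrite !in_itv/= /g.
      by rewrite ltr_pdivrMr// ler_pdivlMr// [s * c]mulrC.
    by rewrite ltr_pdivrMr// ler_pdivlMr// [s * c]mulrC.
  rewrite !lebesgue_measure_itv/= !lte_fin ab ltr_pM2r ?invr_gt0// ab.
  by rewrite -!EFinB -EFinM; congr (_%:E); field; exact: lt0r_neq0.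
move: N0; rewrite E// => /eqP; rewrite [X in X == _]mE mule_eq0 eqe gt_eqF//=.
by move/eqP.
Qed.

Lemma ae_ord (d : measure_display) (T : measurableType d) (R : realType)
    (m : {measure set T -> \bar R}) p (Q : 'I_p -> T -> Prop) :
  (forall i, {ae m, forall x, Q i x}) -> {ae m, forall x, forall i, Q i x}.
Proof.
move=> H.
have : {ae m, forall x, forall k : nat, if insub k is Some i then Q i x else True}.
  apply: ae_foralln => k; case: insub => [i|]; first exact: H.
  exact: aeW.
apply: (@filterS _ _ (ae_filter_ringOfSetsType m)) => x Hx i.
by have := Hx i; rewrite valK.
Qed.

Section Slice.
Context {R : realType} {n p : nat} (phi : 'I_p -> 'rV[R]_n -> R) (L : R).
Hypothesis L0 : 0 <= L.
Hypothesis philip : forall i x y, `|phi i x - phi i y| <= L * `|x - y|.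

(* A single [w] is good for all the points [x + X w / m] at once, and these tend
   to [x]; so no bound on [X] is required. *)
Lemma ae_differentiable_line (x v : 'rV[R]_n) (e : R) : 0 < e ->
  exists2 y, `|y - x| < e &
    {ae (@lebesgue_measure R), forall t, forall i, differentiable (phi i) (y + t *: v)}.
Proof.
move=> e0.
have /choice[N HN] := fun i => rademacher (philip i) L0.
have [d [T [P [X [mX nX]]]]] := @exists_random_vector R n.
pose bad i j m : set (T * measurableTypeR R) :=
  [set wt | N i j (x + inv_nat m *: X wt.1 + wt.2 *: v)].
have mbad i j m : measurable (bad i j m).
  have [/(_ j)[mN _] _] := HN i.
  apply: (mN _ _ (fun wt : T * measurableTypeR R => x + inv_nat m *: X wt.1 + wt.2 *: v)) => k.
  under eq_fun do rewrite !mxE.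
  apply: measurable_funD.
    apply: measurable_funD => //; apply: measurable_funM => //.
    by apply: (measurableT_comp (mX k)); exact: measurable_fst.
  apply: measurable_funM => //; exact: measurable_snd.
have nbad i j m t : P (ysection (bad i j m) t) = 0%E.
  have [/(_ j)[mN nN] _] := HN i.
  rewrite (_ : ysection _ _ = X @^-1` [set y | N i j (x + inv_nat m *: y + t *: v)]); last first.
    by apply/seteqP; split => w /=; rewrite /ysection /= inE.
  apply: (nX j).
    move=> d0 T0 X0 mX0; apply: (mN _ _ (fun w => x + inv_nat m *: X0 w + t *: v)) => k.
    under eq_fun do rewrite !mxE.
    apply: measurable_funD => //; apply: measurable_funD => //.
    by apply: measurable_funM => //; exact: mX0.
  move=> y; have := negligible_dilation (inv_nat_gt0 m) (nN (x + inv_nat m *: y + t *: v)).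
  rewrite (_ : [set s | _] = [set t0 | [set y0 | N i j (x + inv_nat m *: y0 + t *: v)]
     (y + t0 *: delta_mx ord0 j)])//.
  by apply/funext => s /=; congr (N i j _); rewrite scalerDr scalerA; apply/rowP => k;
    rewrite !mxE; ring.
(* For every [t] almost every [w] is good; by Fubini almost every [w] is good for almost every
   [t]. *)
have H : {ae P, forall w, forall i j m, lebesgue_measure (xsection (bad i j m) w) = 0%E}.
  apply: ae_ord => i; apply: ae_ord => j; apply: ae_foralln => m.
  have := @ae_null_xsection _ _ _ _ _ P (@lebesgue_measure R) _ (mbad i j m).
  by apply=> t; exact: nbad.
have [w Hw] : exists w, forall i j m, lebesgue_measure (xsection (bad i j m) w) = 0%E.
  have PT : (0 < P setT)%E by rewrite probability_setT lte01.
  have /filter_ex := H.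
  apply. exact: (ae_properfilter_algebraOfSetsType PT).
have [m me] := inv_nat_lt (divr_gt0 e0 (ltr_wpDl (normr_ge0 (X w)) (@ltr01 R))).
exists (x + inv_nat m *: X w).
  rewrite addrAC subrr add0r normrZ gtr0_norm ?inv_nat_gt0//.
  have X1 : 0 < `|X w| + 1 by rewrite ltr_wpDl.
  move: me; rewrite ltr_pdivlMr//; apply: le_lt_trans.
  by apply: ler_wpM2l; [exact/ltW/inv_nat_gt0|rewrite lerDl].
have : {ae (@lebesgue_measure R), forall t, forall i j, ~ N i j (x + inv_nat m *: X w + t *: v)}.
  apply: ae_ord => i; apply: ae_ord => j.
  exists (xsection (bad i j m) w); split; [exact: measurable_xsection|exact: Hw|].
  by move=> t /= /contrapT Nt; rewrite /xsection /= inE.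
apply: (@filterS _ _ (ae_filter_ringOfSetsType lebesgue_measure)) => t Ht i.
by apply: (HN i).2 => j; exact: Ht.
Qed.

End Slice.

(** * From Hessian bounds to monotonicity of the gradient *)

Lemma is_derive_eps (R : realType) (psi : R -> R) (t d : R) :
  (forall e : R, 0 < e -> exists2 dl : R, 0 < dl &
     forall s, `|s| < dl -> `|psi (t + s) - psi t - s * d| <= e * `|s|) ->
  is_derive t (1 : R) psi d.
Proof.
move=> H.
have lin_d : linear (fun s : R => s * d).
  by move=> k u v; rewrite mulrDl -[k *: u]/(k * u) -[k *: (u * d)]/(k * (u * d)) mulrA.
pose df : {linear R -> R} :=
  HB.pack (fun s : R => s * d) (GRing.isLinear.Build R R R _ (fun s : R => s * d) lin_d).
have cdf : continuous df.
  by move=> s; apply: cvgM; [exact: cvg_id|exact: cvg_cst].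
have [dpsi dE] := is_diff_eps cdf H.
by apply: DeriveDef; [exact: diff_derivable|rewrite deriveE// dE /= mul1r].
Qed.

Lemma differentiable_rowP (R : realType) n m (G : 'rV[R]_n -> 'rV[R]_m) z :
  (forall i, differentiable (fun y => G y ord0 i) z) -> differentiable G z.
Proof.
move=> dG.
pose A := \matrix_(k, i) 'd (fun y => G y ord0 i) z (delta_mx ord0 k).
have AE h i : 'd (fun y => G y ord0 i) z h = (h *m A) ord0 i.
  rewrite {1}(row_sum_delta h) linear_sum mxE; apply: eq_bigr => k _.
  by rewrite linearZ mxE.
have cA : continuous (mulmxr A : {linear 'rV[R]_n -> 'rV[R]_m}).
  apply: bounded_linear_continuous; apply/linear_boundedP.
  exists (n%:R * `|A|); split=> [|r /ltW Ar h]; first exact: num_real.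
  have r0 : 0 <= r by apply: le_trans Ar; rewrite mulr_ge0.
  apply/mx_norm_leP => [|i j]; first by rewrite mulr_ge0.
  rewrite (ord1 i) /= mxE; apply: (le_trans (ler_norm_sum _ _ _)).
  apply: (@le_trans _ _ (\sum_(k < n) (`|h| * `|A|))).
    by apply: ler_sum => k _; rewrite normrM ler_pM// coord_le_mx_norm.
  by rewrite sumr_const card_ord -mulr_natl [`|h| * _]mulrC mulrA ler_wpM2r.
apply: (proj1 (is_diff_eps cA _)) => e e0.
have /choice[d Hd] : forall i, exists d, 0 < d /\ forall h, `|h| < d ->
    `|G (z + h) ord0 i - G z ord0 i - (h *m A) ord0 i| <= e * `|h|.
  move=> i; have [d d0 Hd] := differentiable_eps (dG i) e0.
  by exists d; split=> // h; rewrite -AE; exact: Hd.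
exists (\big[Num.min/1]_i d i).
  by apply: lt_bigmin => // i _; have [] := Hd i.
move=> h hd; apply/mx_norm_leP => [|i j]; first by rewrite mulr_ge0// ltW.
rewrite (ord1 i) !mxE; have [_ /(_ h)] := Hd j; rewrite mxE; apply.
by apply: lt_le_trans hd _; exact: bigmin_le_cond.
Qed.

Section Clip.
Context {R : realType} {n : nat}.

(** For [rho >= 0], a retraction onto the closed max-norm ball of radius [rho] about [c]. Truncation
    coordinate by coordinate is 1-Lipschitz in this norm. *)
Definition clip (c : 'rV[R]_n) (rho : R) (y : 'rV[R]_n) : 'rV[R]_n :=
  \row_i Num.max (c ord0 i - rho) (Num.min (y ord0 i) (c ord0 i + rho)).

Lemma clip_lip c rho y z : `|clip c rho y - clip c rho z| <= `|y - z|.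
Proof.
apply/mx_norm_leP => // i j; rewrite (ord1 i) !mxE.
apply: le_trans (coord_le_mx_norm _ ord0 j); rewrite !mxE.
set a := y _ _; set b := z _ _; set l := _ - rho; set u := _ + rho.
have maxE (p q : R) : (Num.max p q = p /\ q <= p) \/ (Num.max p q = q /\ p <= q).
  by case: (leP p q) => [|/ltW] ?; [right|left].
have minE (p q : R) : (Num.min p q = p /\ p <= q) \/ (Num.min p q = q /\ q <= p).
  by case: (leP p q) => [|/ltW] ?; [left|right].
case: (ger0P (a - b)) => ?; rewrite ler_norml;
  case: (maxE l (Num.min a u)) => -[-> +]; case: (maxE l (Num.min b u)) => -[-> +];
  case: (minE a u) => -[-> +]; case: (minE b u) => -[-> +] => *;
  apply/andP; split; lra.
Qed.

Lemma clip_dist c rho y : 0 <= rho -> `|clip c rho y - c| <= rho.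
Proof.
move=> r0; apply/mx_norm_leP => // i j; rewrite (ord1 i) !mxE.
rewrite ler_norml /Num.max; set m := Num.min _ _.
have mu : m <= c ord0 j + rho by rewrite ge_min lexx orbT.
by case: ifPn; rewrite -?leNgt => ?; apply/andP; split; lra.
Qed.

Lemma clip_id c rho y : `|y - c| <= rho -> clip c rho y = y.
Proof.
move=> H; apply/rowP => i; rewrite mxE.
have := le_trans (coord_le_mx_norm (y - c) ord0 i) H.
rewrite !mxE ler_norml => /andP[h1 h2].
by rewrite min_l ?max_r//; lra.
Qed.

End Clip.

Section HessianMonotone.
Context {R : realType} {n : nat} (g : 'rV[R]_n -> R) (c : 'rV[R]_n) (r L : R).
Hypothesis L0 : 0 <= L.
Hypothesis dg : forall y, `|y - c| < r -> differentiable g y.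
Hypothesis lipg : forall y z, `|y - c| < r -> `|z - c| < r ->
  `|grad g y - grad g z| <= L * `|y - z|.

Lemma twice_differentiable_in y : `|y - c| < r ->
  differentiable (grad g) y -> twice_differentiable g y.
Proof.
move=> yr dgy; split => //.
apply/nbhs_ballP; exists (r - `|y - c|); first by rewrite /= subr_gt0.
move=> z; rewrite -ball_normE /ball_ /= => yz; apply: dg.
have := ler_distD y z c; rewrite [`|z - y|]distrC; lra.
Qed.

Lemma near_eq_differentiable (W : normedModType R) (u v : 'rV[R]_n -> W) z :
  (\forall y \near z, u y = v y) -> differentiable u z -> differentiable v z.
Proof.
move=> uv du.
have cdu : continuous ('d u z : {linear 'rV[R]_n -> W}) by exact: diff_continuous.
apply: (proj1 (is_diff_eps cdu _)) => e e0.
have [d d0 Hd] := differentiable_eps du e0.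
have /nbhs_ballP[d' /= d'0 Hd'] := uv.
exists (Num.min d d'); first by rewrite lt_min d0.
move=> h; rewrite lt_min => /andP[hd hd'].
have uz : u z = v z by exact: nbhs_singleton uv.
rewrite -uz -Hd'; first exact: Hd.
by rewrite -ball_normE /ball_ /= opprD addrA subrr sub0r normrN.
Qed.

(* Composing with [clip] makes the gradient globally Lipschitz without changing
   it near the segment. *)
Lemma hess_monotone (v y : 'rV[R]_n) (eta : R) :
  (forall z, `|z - c| < r -> twice_differentiable g z ->
     eta <= dotv (v *m hess g z) v) ->
  `|y - c| < r -> `|y + v - c| < r ->
  eta <= dotv (grad g (y + v) - grad g y) v.
Proof.
move=> Hv yr yvr.
pose m := Num.max `|y - c| `|y + v - c|.
have mr : m < r by rewrite gt_max yr yvr.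
(* Strictly between [m] and [r]: clipping stays where the gradient is Lipschitz, and the segment
   keeps a margin within which it can be moved. *)
pose rho := (m + r) / 2.
have mrho : m < rho by rewrite /rho; lra.
have rhor : rho < r by rewrite /rho; lra.
have rho0 : 0 <= rho by apply: le_trans (ltW mrho); rewrite le_max normr_ge0.
pose phi (i : 'I_n) z := grad g (clip c rho z) ord0 i.
have cr z : `|clip c rho z - c| < r by exact: le_lt_trans (clip_dist _ _ rho0) rhor.
have phil i z z' : `|phi i z - phi i z'| <= L * `|z - z'|.
  apply: (le_trans (coord_dist_le_mx_norm _ _ _ _)).
  by apply: (le_trans (lipg (cr _) (cr _))); rewrite ler_wpM2l// clip_lip.
pose C := \sum_(i < n) `|v ord0 i|.
have C0 : 0 <= C by apply: sumr_ge0 => i _.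
apply/ler_addgt0Pr => e e0.
have K0 : 0 < 2 * C * L + 1 by rewrite ltr_wpDl// !mulr_ge0.
(* The first bound keeps the moved segment inside the ball of radius [rho]; the second makes the
   cost of moving both endpoints back, [2 * C * L * |y' - y|], at most [e]. *)
pose e1 := Num.min (rho - m) (e / (2 * C * L + 1)).
have e10 : 0 < e1 by rewrite lt_min subr_gt0 mrho divr_gt0.
(* The segment from [y] may lie wholly in the set of nondifferentiability; a parallel one nearby
   meets it in a null set. *)
have [y' y'y aeD] := ae_differentiable_line L0 phil y v e10.
move: (y'y); rewrite lt_min => /andP[y'rho y'e].
have in_rho t : 0 <= t -> t <= 1 -> `|y' + t *: v - c| < rho.
  move=> t0 t1.
  have -> : y' + t *: v - c = (y' - y) + ((1 - t) *: (y - c) + t *: (y + v - c)).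
    by apply/rowP => i; rewrite !mxE; ring.
  apply: (le_lt_trans (ler_normD _ _)).
  have : `|(1 - t) *: (y - c) + t *: (y + v - c)| <= m.
    apply: (le_trans (ler_normD _ _)); rewrite !normrZ !ger0_norm ?subr_ge0//.
    have h1 : (1 - t) * `|y - c| <= (1 - t) * m by rewrite ler_wpM2l ?subr_ge0// le_max lexx.
    have h2 : t * `|y + v - c| <= t * m by rewrite ler_wpM2l// le_max lexx orbT.
    by lra.
  by lra.
pose psi (t : R) := \sum_(i < n) phi i (y' + t *: v) * v ord0 i.
have psiE t : psi t = dotv (grad g (clip c rho (y' + t *: v))) v by [].
have psil s t : `|psi s - psi t| <= (L * C * `|v|) * `|s - t|.
  rewrite /psi -sumrB; apply: (le_trans (ler_norm_sum _ _ _)).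
  apply: (@le_trans _ _ (\sum_(i < n) (L * (`|s - t| * `|v|)) * `|v ord0 i|)).
    apply: ler_sum => i _; rewrite -mulrBl normrM ler_wpM2r//.
    apply: (le_trans (phil _ _ _)); rewrite ler_wpM2l//.
    by rewrite opprD addrACA subrr add0r -scalerBl normrZ.
  by rewrite -mulr_sumr -/C; lra.
have psi_inc : eta * (1 - 0) <= psi 1 - psi 0.
  apply: (lipschitz_increment_ge psil) => //.
  move: aeD; apply: (@filterS _ _ (ae_filter_ringOfSetsType lebesgue_measure)).
  move=> t Ht t0 t1 d dpsi.
  set z := y' + t *: v.
  have zrho : `|z - c| < rho by apply: in_rho; exact: ltW.
  have zr : `|z - c| < r by exact: lt_trans rhor.
  have near_z : \forall w \near z, clip c rho w = w.
    apply/nbhs_ballP; exists (rho - `|z - c|); first by rewrite /= subr_gt0.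
    move=> w; rewrite -ball_normE /ball_ /= => zw; apply: clip_id.
    have := ler_distD z w c; rewrite [`|w - z|]distrC; lra.
  have dG : differentiable (grad g) z.
    apply: differentiable_rowP => i; apply: near_eq_differentiable (Ht i).
    by apply: filterS near_z => w; rewrite /phi => ->.
  apply: (le_trans (Hv z zr (twice_differentiable_in zr dG))).
  (* Derivatives are unique, so the given [d] is the value of the Hessian form at [z]. *)
  suff : is_derive t (1 : R) psi (dotv (v *m hess g z) v).
    by case=> _ <-; case: dpsi => _ <-.
  apply: is_derive_eps => e2 e20.
  have v1 : 0 < C * `|v| + 1 by rewrite ltr_wpDl// mulr_ge0.
  have e30 : 0 < e2 / (C * `|v| + 1) by rewrite divr_gt0.
  have [d1 d10 Hd1] := differentiable_eps dG e30.
  have /nbhs_ballP[d2 /= d20 Hd2] := near_z.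
  pose dl := Num.min d1 d2 / (`|v| + 1).
  have vv : 0 < `|v| + 1 by rewrite ltr_wpDl.
  exists dl; first by rewrite divr_gt0// lt_min d10 d20.
  move=> s; rewrite ltr_pdivlMr// => sd.
  have : `|s *: v| < Num.min d1 d2.
    by apply: le_lt_trans sd; rewrite normrZ ler_wpM2l// lerDl.
  rewrite lt_min => /andP[sd1 sd2].
  rewrite !psiE scalerDl addrA -/z (nbhs_singleton near_z) Hd2; last first.
    by rewrite -ball_normE /ball_ /= opprD addrA subrr sub0r normrN.
  have -> : s * dotv (v *m hess g z) v = dotv ('d (grad g) z (s *: v)) v.
    by rewrite /hess /jacobian mul_rV_lin1 linearZ /= ![dotv _ v]dotvC dotvZr.
  rewrite -!dotvBl dotvC; apply: (le_trans (dotv_bound _ _)); rewrite -/C.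
  apply: (@le_trans _ _ (C * (e2 / (C * `|v| + 1) * `|s *: v|))).
    by rewrite ler_wpM2l//; exact: Hd1.
  rewrite normrZ.
  have -> : C * (e2 / (C * `|v| + 1) * (`|s| * `|v|)) =
     (e2 * `|s|) * (C * `|v| / (C * `|v| + 1)) by field; exact: lt0r_neq0.
  apply: ler_piMr; first by rewrite mulr_ge0// ltW.
  by rewrite ler_pdivrMr// mul1r lerDl.
rewrite subr0 mulr1 !psiE scale1r scale0r addr0 in psi_inc.
apply: (le_trans psi_inc).
have b0 : `|y' - c| < rho.
  by have := in_rho 0 (lexx _) ler01; rewrite scale0r addr0.
have b1 : `|y' + v - c| < rho.
  by have := in_rho 1 ler01 (lexx _); rewrite scale1r.
rewrite (clip_id (ltW b0)) (clip_id (ltW b1)).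
have y'r : `|y' - c| < r by exact: lt_trans rhor.
have y'vr : `|y' + v - c| < r by exact: lt_trans rhor.
have near_grad z z' : `|z - c| < r -> `|z' - c| < r -> `|z - z'| <= `|y' - y| ->
    `|dotv (grad g z - grad g z') v| <= C * (L * `|y' - y|).
  move=> zr z'r zz'; rewrite dotvC; apply: (le_trans (dotv_bound _ _)).
  by rewrite -/C ler_wpM2l//; apply: (le_trans (lipg zr z'r)); rewrite ler_wpM2l.
have H1 : `|dotv (grad g (y' + v) - grad g (y + v)) v| <= C * (L * `|y' - y|).
  apply: near_grad => //.
  have -> : y' + v - (y + v) = y' - y by rewrite opprD addrACA subrr addr0.
  exact: lexx.
have H2 : `|dotv (grad g y' - grad g y) v| <= C * (L * `|y' - y|) by exact: near_grad.
have H3 : 2 * C * L * `|y' - y| <= e.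
  apply: (@le_trans _ _ ((2 * C * L + 1) * `|y' - y|)).
    by rewrite ler_wpM2r// lerDl.
  by rewrite mulrC -ler_pdivlMr// ltW.
move: H1 H2; rewrite !dotvBl !ler_norml => /andP[_ h1] /andP[h2 _].
move: H3; lra.
Qed.

End HessianMonotone.

Section Gradient.
Context {R : realType} {n : nat}.
Implicit Types (g : 'rV[R]_n -> R).

Lemma diff_grad g z v : differentiable g z -> 'd g z v = dotv (grad g z) v.
Proof.
move=> dg; rewrite {1}(row_sum_delta v) linear_sum; apply: eq_bigr => i _.
by rewrite linearZ /= mxE deriveE// mulrC.
Qed.

Lemma is_derive_line g (c v : 'rV[R]_n) (t : R) : differentiable g (c + t *: v) ->
  is_derive t (1 : R) (fun s => g (c + s *: v)) (dotv (grad g (c + t *: v)) v).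
Proof.
move=> dg; apply: is_derive_eps => e e0.
have v1 : 0 < `|v| + 1 by rewrite ltr_wpDl.
have [d d0 Hd] := differentiable_eps dg (divr_gt0 e0 v1).
exists (d / (`|v| + 1)); first by rewrite divr_gt0.
move=> s; rewrite ltr_pdivlMr// => sd.
have sv : `|s *: v| < d.
  by apply: le_lt_trans sd; rewrite normrZ ler_wpM2l// lerDl.
rewrite scalerDl addrA -dotvZr -diff_grad//.
apply: (le_trans (Hd _ sv)); rewrite normrZ.
have -> : e / (`|v| + 1) * (`|s| * `|v|) = (e * `|s|) * (`|v| / (`|v| + 1)).
  by field; exact: lt0r_neq0.
apply: ler_piMr; first by rewrite mulr_ge0// ltW.
by rewrite ler_pdivrMr// mul1r lerDl.
Qed.

Lemma mvt_line g (c v : 'rV[R]_n) :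
  (forall t, 0 <= t -> t <= 1 -> differentiable g (c + t *: v)) ->
  exists t, [/\ 0 < t, t < 1 & g (c + v) - g c = dotv (grad g (c + t *: v)) v].
Proof.
move=> dg; have [||t] := @MVT R (fun s => g (c + s *: v))
    (fun s => dotv (grad g (c + s *: v)) v) 0 1 ltr01.
- move=> t; rewrite in_itv/= => /andP[t0 t1]; apply: is_derive_line.
  by apply: dg; exact: ltW.
- apply: derivable_within_continuous => t; rewrite in_itv/= => /andP[t0 t1].
  by have [] := is_derive_line (dg t t0 t1).
rewrite in_itv/= => /andP[t0 t1]; rewrite scale1r scale0r addr0 subr0 mulr1 => E.
by exists t.
Qed.

Lemma jacobian_bound m (G : 'rV[R]_n -> 'rV[R]_m) z (L d : R) : 0 < d ->
  (forall y, `|y - z| < d -> `|G y - G z| <= L * `|y - z|) ->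
  differentiable G z -> forall h : 'rV[R]_n, `|h *m ('J G z)| <= L * `|h|.
Proof.
move=> d0 lipG dG h; rewrite mul_rV_lin1.
have [->|h0] := eqVneq h 0; first by rewrite linear0 !normr0 mulr0.
have hn : 0 < `|h| by rewrite normr_gt0.
apply/ler_addgt0Pr => e e0.
have [d' d'0 Hd'] := differentiable_eps dG (divr_gt0 e0 hn).
pose s := Num.min d d' / (2 * `|h|).
have s0 : 0 < s by rewrite divr_gt0 ?mulr_gt0// lt_min d0.
have sh : `|s *: h| < Num.min d d'.
  rewrite normrZ gtr0_norm// /s.
  have -> : Num.min d d' / (2 * `|h|) * `|h| = Num.min d d' / 2.
    by field; rewrite normr_eq0.
  by rewrite ltr_pdivrMr// ltr_pMr ?ltr1n// lt_min d0.
move: sh; rewrite lt_min => /andP[shd shd'].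
have H1 : `|G (z + s *: h) - G z| <= L * `|s *: h|.
  have := lipG (z + s *: h); rewrite [z + _]addrC addrK; exact.
have := Hd' _ shd'; rewrite linearZ /=.
move: H1; set D := G _ - G _; set q := 'd G z h => H1 H2.
rewrite -(ler_pM2l s0) -{1}[s]gtr0_norm// -normrZ.
rewrite -[s *: q]opprK -[- (s *: q)](addKr D) opprD opprK.
apply: (le_trans (ler_normB _ _)); apply: le_trans (lerD H1 H2) _.
rewrite normrZ gtr0_norm// (_ : e / `|h| * (s * `|h|) = s * e); last first.
  by field; rewrite normr_eq0.
lra.
Qed.

End Gradient.

(** The indices [s m] need not increase: [m <= s m] is enough to carry over bounds that decrease
    with the index. *)
Lemma bounded_rV_subsequence (R : realType) p (u : nat -> 'rV[R]_p) (B : R) :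
  (forall k, `|u k| <= B) ->
  exists l (s : nat -> nat), forall m, (m <= s m)%N /\ `|u (s m) - l| < inv_nat m.
Proof.
move=> uB; pose K : set 'rV[R]_p := [set z | `|z| <= B].
have cK : compact K.
  apply: bounded_closed_compact.
    exists B; split; first exact: num_real.
    by move=> M BM z /= zB; exact: le_trans zB (ltW BM).
  apply: (preimage_closed _ (@closed_le R B)) => z _; exact: norm_continuous.
have [] := cK (u @ \oo) _ _.
  by exists 0%N => // k _; exact: (uB k).
move=> l [_ cl].
have /choice[s Hs] : forall m, exists k, (m <= k)%N /\ `|u k - l| < inv_nat m.
  move=> m.
  have Am : (u @ \oo) (u @` [set k | (m <= k)%N]).
    by exists m => // k mk; exists k.
  have [z [[k mk <-] zl]] := cl _ _ Am (nbhsx_ballx l _ (inv_nat_gt0 m)).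
  by exists k; split => //; move: zl; rewrite -ball_normE /ball_ /= distrC.
by exists l, s.
Qed.

Lemma cvg_inv_nat (R : realType) p (u : nat -> 'rV[R]_p) l :
  (forall m, `|u m - l| < inv_nat m) -> u @ \oo --> l.
Proof.
move=> H; apply/(@cvgrPdist_lt _ 'rV[R]_p) => e e0.
have [K Ke] := inv_nat_lt e0; exists K => // k Kk /=.
by rewrite distrC (lt_trans (H k))// (le_lt_trans (inv_nat_le Kk)).
Qed.

Section UniformHessian.
Context {R : realType} {n : nat} (g : 'rV[R]_n -> R) (c : 'rV[R]_n) (r L : R)
  (V : set 'rV[R]_n).
Hypothesis r0 : 0 < r.
Hypothesis L0 : 0 <= L.
Hypothesis dg : forall y, `|y - c| < r -> differentiable g y.
Hypothesis lipg : forall y z, `|y - c| < r -> `|z - c| < r ->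
  `|grad g y - grad g z| <= L * `|y - z|.
Hypothesis VZ : forall k v, V v -> V (k *: v).
Hypothesis Vclosed : closed V.
Hypothesis posH : forall H, gen_hess g c H -> forall v, V v -> v != 0 ->
  0 < dotv (v *m H) v.

Lemma gen_hess_limit (u : nat -> 'rV[R]_n) H :
  u @ \oo --> c -> (forall i, twice_differentiable g (u i)) ->
  (fun i => hess g (u i)) @ \oo --> H -> gen_hess g c H.
Proof.
move=> uc tu uH; exists 1%N, (fun=> 1), (fun=> H); split => //.
- by rewrite big_ord_recl big_ord0 addr0.
- by move=> _; exists u.
- by rewrite big_ord_recl big_ord0 addr0 scale1r.
Qed.

Lemma hess_bound y : `|y - c| < r -> twice_differentiable g y ->
  forall i j, `|hess g y i j| <= L.
Proof.
move=> yr [_ d2] i j.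
have d0 : 0 < r - `|y - c| by rewrite subr_gt0.
have lipy z : `|z - y| < r - `|y - c| -> `|grad g z - grad g y| <= L * `|z - y|.
  by move=> zy; apply: lipg => //; have := ler_distD y z c; lra.
have := jacobian_bound d0 lipy d2 (delta_mx ord0 i).
have e1 : `|delta_mx ord0 i : 'rV[R]_n| <= 1.
  apply/mx_norm_leP => // k l; rewrite mxE; case: (_ && _); rewrite ?normr0 ?normr1//.
move=> H; have := le_trans (coord_le_mx_norm _ ord0 j) H.
rewrite -rowE mxE => /le_trans; apply.
by rewrite -[leRHS]mulr1 ler_wpM2l.
Qed.

(** Otherwise there are points tending to [c] and unit vectors of [V] at which the Hessian form is
    below [inv_nat k]. The Hessians are bounded by [L], so along a subsequence they converge to a
    generalized Hessian at [c] and the vectors to a nonzero vector of [V]; the limiting form is at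
    most 0, against [posH]. *)
Lemma uniform_hess_bound : exists eta rho : R, [/\ 0 < eta, 0 < rho, rho <= r &
  forall y v, `|y - c| < rho -> twice_differentiable g y -> V v ->
    eta * `|v| ^+ 2 <= dotv (v *m hess g y) v].
Proof.
apply: contrapT => Hneg.
have /choice[yv Hyv] : forall k : nat, exists yv : 'rV[R]_n * 'rV[R]_n,
   [/\ `|yv.1 - c| < Num.min r (inv_nat k), twice_differentiable g yv.1, V yv.2,
       `|yv.2| = 1 & dotv (yv.2 *m hess g yv.1) yv.2 < inv_nat k].
  move=> k; apply: contrapT => Hk; apply: Hneg.
  exists (inv_nat k), (Num.min r (inv_nat k)); split.
  - exact: inv_nat_gt0.
  - by rewrite lt_min r0 inv_nat_gt0.
  - by rewrite ge_min lexx.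
  move=> y v yc ty Vv; rewrite leNgt; apply/negP => lt.
  have v0 : v != 0.
    by apply/negP => /eqP v0; move: lt; rewrite v0 mul0mx dotv0 normr0 expr0n mulr0 ltxx.
  have vn : 0 < `|v| by rewrite normr_gt0.
  apply: Hk; exists (y, `|v|^-1 *: v) => /=; split => //.
  - exact: VZ.
  - by rewrite normrZ ger0_norm ?invr_ge0// mulVf// gt_eqF.
  rewrite -scalemxAl dotvC !dotvZr dotvC dotvZr mulrA -expr2 exprVn.
  by rewrite mulrC ltr_pdivrMr// exprn_gt0.
pose y k := (yv k).1; pose v k := (yv k).2.
(* Packing the Hessian and the vector into one row lets a single extraction serve both. *)
pose u k : 'rV[R]_(n * n + n) := row_mx (mxvec (hess g (y k))) (v k).
have uB k : `|u k| <= L + 1.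
  have [yc ty Vv v1 _] := Hyv k.
  apply/mx_norm_leP; first by rewrite addr_ge0.
  move=> i j; rewrite (ord1 i) -[j]fintype.splitK; case: (fintype.split j) => l /=.
    rewrite row_mxEl; case/mxvec_indexP: l => a b; rewrite mxvecE.
    apply: (@le_trans _ _ L); last by rewrite lerDl.
    by apply: hess_bound => //; move: yc; rewrite lt_min => /andP[].
  rewrite row_mxEr; apply: le_trans (coord_le_mx_norm _ _ _) _.
  by rewrite v1 lerDr.
have [l [s Hs]] := bounded_rV_subsequence uB.
pose H : 'M[R]_n := vec_mx (lsubmx l); pose w : 'rV[R]_n := rsubmx l.
have Hclose m a b : `|hess g (y (s m)) a b - H a b| < inv_nat m.
  apply: le_lt_trans (proj2 (Hs m)).
  have := coord_dist_le_mx_norm (u (s m)) l ord0 (lshift n (mxvec_index a b)).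
  by rewrite row_mxEl mxvecE /H !mxE.
have wclose m : `|v (s m) - w| < inv_nat m.
  apply/mx_norm_ltP => [|i j]; first exact: inv_nat_gt0.
  apply: le_lt_trans (proj2 (Hs m)); rewrite (ord1 i).
  have := coord_dist_le_mx_norm (u (s m)) l ord0 (rshift (n * n) j).
  by rewrite row_mxEr /w !mxE.
have yc : (fun m => y (s m)) @ \oo --> c.
  apply: cvg_inv_nat => m; have [+ _ _ _ _] := Hyv (s m).
  rewrite lt_min => /andP[_ h]; apply: lt_le_trans h _.
  by apply: inv_nat_le; case: (Hs m).
have Hc : (fun m => hess g (y (s m))) @ \oo --> H.
  apply/(@cvgrPdist_lt _ 'M[R]_n) => e e0.
  have [K Ke] := inv_nat_lt e0; exists K => // k Kk /=.
  rewrite distrC; apply/mx_norm_ltP => // a b; rewrite [X in `|X|]mxE [X in _ + X]mxE.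
  by rewrite (lt_trans (Hclose k a b))// (le_lt_trans (inv_nat_le Kk)).
have HH : gen_hess g c H.
  by apply: gen_hess_limit yc _ Hc => m; have [] := Hyv (s m).
have vw : (fun m => v (s m)) @ \oo --> w by exact: cvg_inv_nat.
have Vw : V w.
  apply: Vclosed => B /vw [N _ HN]; exists (v (s N)); split; last exact: (HN N (leqnn N)).
  by have [] := Hyv (s N).
(* Index 0 is enough: [inv_nat 0] is 1, and a unit vector at distance less than 1 from [w] rules out
   [w = 0]. *)
have w0 : w != 0.
  apply/negP => /eqP w0; have := wclose 0%N; rewrite w0 subr0.
  by have [_ _ _ v1 _] := Hyv (s 0%N); rewrite /v v1 /inv_nat invr1 ltxx.
have := posH HH Vw w0; rewrite ltNge => /negP; apply.
have quad (Q : 'M[R]_n) (z : 'rV[R]_n) :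
    dotv (z *m Q) z = \sum_i \sum_j z ord0 j * Q j i * z ord0 i.
  by apply: eq_bigr => i _; rewrite mxE mulr_suml.
have coord_cvg i j (f : nat -> 'M[R]_(i, j)) (F : 'M[R]_(i, j)) a b :
    f @ \oo --> F -> (fun m => f m a b) @ \oo --> F a b.
  move=> fF; apply: (@cvg_comp _ _ _ f (fun M : 'M[R]_(i, j) => M a b) _ _ _ fF).
  exact: coord_continuous.
have cq : (fun m => dotv (v (s m) *m hess g (y (s m))) (v (s m))) @ \oo --> dotv (w *m H) w.
  rewrite quad; under eq_fun do rewrite quad.
  apply: cvg_big; first exact: add_continuous.
  move=> i _; apply: cvg_big; first exact: add_continuous.
  move=> j _; apply: cvgM; last exact: coord_cvg.
  by apply: cvgM; exact: coord_cvg.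
apply/ler_addgt0Pr => e e0; rewrite add0r.
apply: (ler_cvg_to cq (cvg_cst e)).
have [K Ke] := inv_nat_lt e0; exists K => // k Kk /=.
have [_ _ _ _ h] := Hyv (s k); apply: ltW; apply: (lt_trans h).
by apply: le_lt_trans Ke; apply: inv_nat_le; exact: leq_trans Kk (proj1 (Hs k)).
Unshelve. all: by end_near. Qed.

End UniformHessian.

(** * The penalty and the local growth of F *)

Section Abspow.
Context {R : realType} (q : R).
Hypothesis q_ge0 : 0 <= q.
Hypothesis q_lt1 : q < 1.

Lemma abspow0 : abspow q (0 : R) = 0.
Proof. by rewrite /abspow eqxx. Qed.

Lemma abspowE (t : R) : t != 0 -> abspow q t = `|t| `^ q.
Proof. by rewrite /abspow => /negbTE ->. Qed.

Lemma abspow_ge0 (t : R) : 0 <= abspow q t.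
Proof. by rewrite /abspow; case: ifPn => // _; exact: powR_ge0. Qed.

Lemma abspowN (t : R) : abspow q (- t) = abspow q t.
Proof. by rewrite /abspow oppr_eq0 normrN. Qed.

(* The derivative of [abspow q] away from 0; junk at 0. *)
Definition dabspow (t : R) : R := Num.sg t * (q * `|t| `^ (q - 1)).

Lemma is_derive_oppr (u : R -> R) (t : R) d :
  is_derive (- t) (1 : R) u d -> is_derive t (1 : R) (fun s => u (- s)) (- d).
Proof.
move=> [/derivable1_diffP du <-]; apply: is_derive_eps => e e0.
have [dl dl0 H] := differentiable_eps du e0; exists dl => // s sd.
have := H (- s); rewrite normrN => /(_ sd).
rewrite deriveE// -opprD (_ : 'd u (- t) (- s) = - (s * 'd u (- t) 1)).
  by rewrite mulrN.
by rewrite linearN -{1}[s]mulr1 -[s * 1]/(s *: (1 : R)) linearZ.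
Qed.

Lemma is_derive_abspow (t : R) : t != 0 -> is_derive t (1 : R) (abspow q) (dabspow t).
Proof.
have pos (s : R) : 0 < s -> is_derive s (1 : R) (abspow q) (q * s `^ (q - 1)).
  move=> s0; apply: near_eq_is_derive (is_derive1_powR q s0).
  near=> z; have z0 : 0 < z by near: z; exact: lt_nbhsr.
  by rewrite abspowE ?gt_eqF// gtr0_norm.
case: (ltgtP t 0) => // t0 _; rewrite /dabspow.
  rewrite ltr0_sg// ltr0_norm// mulN1r.
  rewrite -[abspow q](_ : (fun s => abspow q (- s)) = _); last first.
    by apply/funext => s; rewrite abspowN.
  by apply: is_derive_oppr; apply: pos; rewrite oppr_gt0.
by rewrite gtr0_sg// gtr0_norm// mul1r; exact: pos.
Unshelve. all: by end_near. Qed.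

(** On the positive half-line the second derivative [q * (q - 1) * s^(q - 2)] does not grow in
    absolute value with [s], so its value at [t0 / 2] bounds it on the neighbourhood, and the mean
    value theorem applies. *)
Lemma dabspow_lipschitz_pos (t0 : R) : 0 < t0 -> exists C : R, 0 <= C /\
  forall s s', `|s - t0| < t0 / 2 -> `|s' - t0| < t0 / 2 ->
    `|dabspow s - dabspow s'| <= C * `|s - s'|.
Proof.
move=> t00.
pose C := `|q * (q - 1)| * (t0 / 2) `^ (q - 2).
have C0 : 0 <= C by rewrite mulr_ge0// powR_ge0.
have tt : 0 < t0 / 2 by rewrite divr_gt0.
exists C; split => //.
have dd s : t0 / 2 < s -> is_derive s (1 : R) (fun z => q * z `^ (q - 1))
    (q * ((q - 1) * s `^ (q - 1 - 1))).
  move=> s0; have s00 : 0 < s by exact: lt_trans s0.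
  have := is_deriveZ q (is_derive1_powR (q - 1) s00); exact.
have bd s : t0 / 2 < s -> `|q * ((q - 1) * s `^ (q - 1 - 1))| <= C.
  move=> s0; have s00 : 0 < s by exact: lt_trans s0.
  rewrite mulrA normrM /C ler_wpM2l//.
  rewrite ger0_norm ?powR_ge0// (_ : q - 1 - 1 = - (2 - q)); last by ring.
  rewrite (_ : q - 2 = - (2 - q)); last by ring.
  rewrite !powRN lef_pV2 ?posrE ?powR_gt0//.
  apply: ge0_ler_powR; rewrite ?nnegrE; [|exact: ltW..].
  by rewrite subr_ge0; apply: (le_trans (ltW q_lt1)); rewrite ler1n.
have main a b : t0 / 2 < a -> a <= b ->
    `|q * b `^ (q - 1) - q * a `^ (q - 1)| <= C * `|b - a|.
  move=> a0 ab; have [||c] := @MVT_segment R (fun z => q * z `^ (q - 1))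
      (fun s => q * ((q - 1) * s `^ (q - 1 - 1))) a b ab.
  - by move=> z; rewrite in_itv/= => /andP[az _]; apply: dd; exact: lt_trans az.
  - apply: derivable_within_continuous => z; rewrite in_itv/= => /andP[az _].
    by have [] := dd z (lt_le_trans a0 az).
  rewrite in_itv/= => /andP[ac _] ->; rewrite normrM ler_wpM2r//.
  by apply: bd; exact: lt_le_trans ac.
move=> s s'; rewrite !ltr_norml => /andP[s1 _] /andP[s2 _].
have h1 : t0 / 2 < s by lra.
have h2 : t0 / 2 < s' by lra.
have s0 := lt_trans tt h1; have s'0 := lt_trans tt h2.
rewrite /dabspow (gtr0_sg s0) (gtr0_sg s'0) (gtr0_norm s0) (gtr0_norm s'0) !mul1r.
have [ss|/ltW ss] := leP s s'; last exact: main.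
by rewrite distrC [`|s - s'|]distrC; exact: main.
Qed.

Lemma dabspow_lipschitz (t0 : R) : t0 != 0 -> exists C : R, 0 <= C /\
  forall s s', `|s - t0| < `|t0| / 2 -> `|s' - t0| < `|t0| / 2 ->
    `|dabspow s - dabspow s'| <= C * `|s - s'|.
Proof.
have dN s : dabspow (- s) = - dabspow s.
  by rewrite /dabspow sgrN normrN mulNr.
case: (ltgtP t0 0) => // t00 _; last first.
  by rewrite gtr0_norm//; exact: dabspow_lipschitz_pos.
have [|C [C0 HC]] := @dabspow_lipschitz_pos (- t0); first by rewrite oppr_gt0.
exists C; split=> // s s'; rewrite (ltr0_norm t00) => h1 h2.
have nE (a b : R) : `|- a - - b| = `|a - b| by rewrite -opprD normrN.
by have := HC (- s) (- s'); rewrite !dN !nE; apply.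
Qed.

(** Write [|t| = |t|^(1-q) * |t|^q]; the first factor is at most [a] as soon as [|t| < a^(1/(1-q))].
    This is how the penalty beats first-order changes of [f] at zero entries. *)
Lemma abspow_dominates (a : R) : 0 < a -> exists2 d : R, 0 < d &
  forall t, `|t| < d -> `|t| <= a * abspow q t.
Proof.
move=> a0; have q1 : 0 < 1 - q by rewrite subr_gt0.
exists (a `^ (1 - q)^-1); first exact: powR_gt0.
move=> t td; have [->|t0] := eqVneq t 0; first by rewrite normr0 abspow0 mulr0.
have tn : 0 < `|t| by rewrite normr_gt0.
rewrite abspowE// -{1}[`|t|](@powRr1 _ `|t|)// (_ : 1 = (1 - q) + q); last by ring.
rewrite powRD; last by rewrite (gt_eqF tn) implybT.
rewrite ler_wpM2r ?powR_ge0//.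
have -> : a = (a `^ (1 - q)^-1) `^ (1 - q).
  by rewrite -powRrM mulVf ?gt_eqF// powRr1// ltW.
by apply: ge0_ler_powR; rewrite ?nnegrE ?powR_ge0// ltW.
Qed.

(* Comparing a minimizer [t != 0] with [0] and with [2 t] bounds [|t|] from
   below, uniformly in [z]. *)
Lemma abspow_prox_gap (a : R) : 0 < a -> exists2 c : R, 0 < c &
  forall z t : R, (forall s, 2^-1 * (z - t) ^+ 2 + a * abspow q t
     <= 2^-1 * (z - s) ^+ 2 + a * abspow q s) -> t != 0 -> c <= `|t|.
Proof.
move=> a0; pose kappa := a * (2 - 2 `^ q).
have k0 : 0 < kappa.
  rewrite mulr_gt0// subr_gt0.
  by rewrite -[ltRHS](@powRr1 R 2)// /powR pnatr_eq0/= ltr_expR ltr_pM2r// ln_gt0// ltr1n.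
exists (Num.min 1 kappa); first by rewrite lt_min ltr01.
move=> z t H t0; have tn : 0 < `|t| by rewrite normr_gt0.
have H0 := H 0; have H2 := H (2 * t).
have t20 : 2 * t != 0 by rewrite mulf_neq0.
move: H0 H2; rewrite abspow0 mulr0 addr0 !abspowE// normrM powRM// (@ger0_norm _ 2)//.
set p := `|t| `^ q => H0 H2.
(* The comparisons with [0] and [2 * t] have opposite cross terms [z * t], so their sum no longer
   involves [z]. *)
have key : kappa * p <= `|t| ^+ 2.
  by rewrite -normrX ger0_norm ?sqr_ge0// /kappa; lra.
have [t1|t1] := leP 1 `|t|; first by rewrite ge_min t1.
rewrite ge_min; apply/orP; right.
have tp : `|t| <= p.
  by apply: ger1_powR; [rewrite tn ltW | exact: ltW].
rewrite -(ler_pM2r tn) -expr2; apply: le_trans key.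
by rewrite ler_wpM2l// ltW.
Qed.

End Abspow.

Section Enorm.
Context {R : realType} {n : nat}.
Implicit Types x y : 'rV[R]_n.

Lemma dotv_ge0 x : 0 <= dotv x x.
Proof. by apply: sumr_ge0 => i _; rewrite -expr2 sqr_ge0. Qed.

Lemma enorm_sqr x : enorm x ^+ 2 = \sum_(i < n) x ord0 i ^+ 2.
Proof. by rewrite /enorm sqr_sqrtr ?dotv_ge0. Qed.

Lemma enorm_ge0 x : 0 <= enorm x.
Proof. exact: sqrtr_ge0. Qed.

Lemma mx_norm_le_enorm x : `|x| <= enorm x.
Proof.
apply/mx_norm_leP; first exact: enorm_ge0.
move=> i j; rewrite (ord1 i) -(@ler_pXn2r _ 2) ?nnegrE ?enorm_ge0//.
rewrite -normrX ger0_norm ?sqr_ge0// enorm_sqr (bigD1 j)//= lerDl.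
by apply: sumr_ge0 => k _; rewrite sqr_ge0.
Qed.

Lemma enorm_sqr_le x : enorm x ^+ 2 <= n%:R * `|x| ^+ 2.
Proof.
rewrite enorm_sqr; apply: (@le_trans _ _ (\sum_(i < n) `|x| ^+ 2)).
  apply: ler_sum => i _; rewrite -[leLHS]ger0_norm ?sqr_ge0// normrX.
  by rewrite ler_pXn2r ?nnegrE// coord_le_mx_norm.
by rewrite sumr_const card_ord mulr_natl.
Qed.

Lemma enorm_le x : enorm x <= n%:R * `|x|.
Proof.
rewrite -(@ler_pXn2r _ 2) ?nnegrE ?enorm_ge0 ?mulr_ge0//.
apply: (le_trans (enorm_sqr_le x)); rewrite exprMn ler_wpM2r ?sqr_ge0//.
by rewrite -natrX ler_nat; case: n => // m; rewrite leq_pmull.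
Qed.

Lemma enormN x : enorm (- x) = enorm x.
Proof. by rewrite /enorm /dotv; under eq_bigr do rewrite !mxE mulrNN. Qed.

Lemma enorm_sqr_continuous : continuous (fun x : 'rV[R]_n => enorm x ^+ 2).
Proof.
under eq_fun do rewrite enorm_sqr.
apply: continuous_big; first exact: add_continuous.
move=> i _; under eq_fun do rewrite expr2.
by move=> x; apply: (@continuousM _ _ (fun y : 'rV[R]_n => y ord0 i)); exact: coord_continuous.
Qed.

End Enorm.

Lemma is_derive_epsP (R : realType) (u : R -> R) (t d : R) :
  is_derive t (1 : R) u d -> forall e : R, 0 < e -> exists2 dl : R, 0 < dl &
     forall s, `|s| < dl -> `|u (t + s) - u t - s * d| <= e * `|s|.
Proof.
move=> [/derivable1_diffP du <-] e e0.
have [dl dl0 H] := differentiable_eps du e0; exists dl => // s sd.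
rewrite deriveE// (_ : s * 'd u t 1 = 'd u t s); first exact: H.
by rewrite -{2}[s]mulr1 -[s * 1]/(s *: (1 : R)) linearZ.
Qed.

Section Epart.
Context {R : realType} {n : nat} (f : 'rV[R]_n -> R) (lambda q : R).
Hypothesis lambda_gt0 : 0 < lambda.
Hypothesis q_ge0 : 0 <= q.
Hypothesis q_lt1 : q < 1.
Implicit Types (S : {set 'I_n}) (y : 'rV[R]_n).

Lemma lqq_subv S y : lqq q (subv S y) = \sum_(i in S) abspow q (y ord0 i).
Proof.
rewrite /lqq [RHS]big_enum_val.
by apply: eq_bigr => i _; rewrite mxE.
Qed.

Lemma FobjE S y : Fobj f lambda q y =
  Epart f lambda q S y + lambda * \sum_(i | i \notin S) abspow q (y ord0 i).
Proof.
rewrite /Fobj /Epart lqq_subv -addrA -mulrDr; congr (_ + _ * _).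
by rewrite /lqq (bigID (mem S)).
Qed.

Lemma Fobj_Epart S y : (forall i, i \notin S -> y ord0 i = 0) ->
  Fobj f lambda q y = Epart f lambda q S y.
Proof.
move=> y0; rewrite (FobjE S) big1 ?mulr0 ?addr0// => i iS.
by rewrite y0// abspow0.
Qed.

Definition grad_Epart S y : 'rV[R]_n :=
  grad f y + \row_i (if i \in S then lambda * dabspow q (y ord0 i) else 0).

Lemma Epart_differentiable S y : (forall i, i \in S -> y ord0 i != 0) ->
  differentiable f y ->
  differentiable (Epart f lambda q S) y /\
  grad (Epart f lambda q S) y = grad_Epart S y.
Proof.
move=> yS df.
suff [dE dEE] : differentiable (Epart f lambda q S) y /\
    'd (Epart f lambda q S) y = dotl (grad_Epart S y) :> ('rV[R]_n -> R).
  split => //; apply/rowP => i; rewrite [LHS]mxE deriveE// dEE /=.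
  by rewrite -[delta_mx _ _]scale1r dotv_evec mul1r.
apply: is_diff_eps; first exact: dotl_continuous.
(* At most [n] penalty terms, weighted by [lambda], then cost at most half of [e]; the other half
   goes to [f]. Using [n + 1] keeps the divisor positive when [n = 0]. *)
move=> e e0; pose e' := e / (2 * (lambda * (n%:R + 1))).
have n1 : 0 < n%:R + 1 :> R by rewrite ltr_wpDl.
have e'0 : 0 < e' by rewrite divr_gt0// mulr_gt0// mulr_gt0.
have e20 : 0 < e / 2 by rewrite divr_gt0.
have [d1 d10 Hd1] := differentiable_eps df e20.
have /choice[d Hd] : forall i, exists d : R, 0 < d /\ (i \in S -> forall s, `|s| < d ->
    `|abspow q (y ord0 i + s) - abspow q (y ord0 i) - s * dabspow q (y ord0 i)| <= e' * `|s|).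
  move=> i; case iS: (i \in S); last by exists 1.
  have [d d0 H] := is_derive_epsP (is_derive_abspow q (yS i iS)) e'0.
  by exists d.
exists (Num.min d1 (\big[Num.min/1]_i d i)).
  by rewrite lt_min d10 lt_bigmin// => i _; have [] := Hd i.
move=> h; rewrite lt_min => /andP[hd1 hd].
rewrite -[dotl _ h]/(dotv (grad_Epart S y) h) /Epart !lqq_subv.
have -> : dotv (grad_Epart S y) h = dotv (grad f y) h +
    lambda * \sum_(i in S) h ord0 i * dabspow q (y ord0 i).
  rewrite /grad_Epart dotvC dotvDr dotvC; congr (_ + _).
  rewrite mulr_sumr [RHS]big_mkcond; apply: eq_bigr => i _.
  by rewrite mxE; case: ifP => _; [ring|rewrite mulr0].
rewrite (_ : _ - _ = (f (y + h) - f y - dotv (grad f y) h) + lambda *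
  \sum_(i in S) (abspow q (y ord0 i + h ord0 i) - abspow q (y ord0 i)
     - h ord0 i * dabspow q (y ord0 i))); last first.
  rewrite !sumrB; under eq_bigr do rewrite mxE; ring.
apply: (le_trans (ler_normD _ _)).
have -> : e * `|h| = e / 2 * `|h| + e / 2 * `|h| by field.
rewrite lerD//; first by rewrite -diff_grad//; exact: Hd1.
rewrite normrM (gtr0_norm lambda_gt0).
apply: (@le_trans _ _ (lambda * (n%:R * (e' * `|h|)))).
  apply: ler_wpM2l; [exact: ltW|apply: (le_trans (ler_norm_sum _ _ _))].
  apply: (@le_trans _ _ (\sum_(i in S) e' * `|h|)).
    apply: ler_sum => i iS; have [_ /(_ iS)] := Hd i.
    move=> /(_ (h ord0 i)) H; apply: (le_trans (H _)).
      apply: le_lt_trans (coord_le_mx_norm _ _ _) _; apply: lt_le_trans hd _.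
      exact: bigmin_le_cond.
    by apply: ler_wpM2l; [exact: ltW|exact: coord_le_mx_norm].
  rewrite sumr_const -[leLHS]mulr_natl; apply: ler_wpM2r; first by rewrite mulr_ge0// ltW.
  by rewrite ler_nat -[leqRHS]card_ord max_card.
rewrite /e'.
have -> : lambda * (n%:R * (e / (2 * (lambda * (n%:R + 1))) * `|h|)) =
   (e / 2 * `|h|) * (n%:R / (n%:R + 1)).
  by field; rewrite !gt_eqF.
apply: ler_piMr; first by rewrite mulr_ge0// ltW.
by rewrite ler_pdivrMr// mul1r lerDl.
Qed.

Lemma Epart_LC1 (xs : 'rV[R]_n) (r1 L : R) : 0 < r1 -> 0 <= L ->
  (forall y, differentiable f y) ->
  (forall y z, `|y - xs| < r1 -> `|z - xs| < r1 ->
     `|grad f y - grad f z| <= L * `|y - z|) ->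
  exists r L' : R, [/\ 0 < r, 0 <= L',
    forall y, `|y - xs| < r -> forall i, i \in supp xs -> y ord0 i != 0 &
    forall y z, `|y - xs| < r -> `|z - xs| < r ->
     `|grad (Epart f lambda q (supp xs)) y - grad (Epart f lambda q (supp xs)) z|
        <= L' * `|y - z|].
Proof.
move=> r10 L0 df lipf; set S := supp xs.
have SE i : (i \in S) = (xs ord0 i != 0) by rewrite inE.
(* Staying within half of each nonzero entry of [xs] keeps the entries in [S] away from 0, where the
   penalty is smooth. *)
pose r := Num.min r1 (\big[Num.min/1]_(i in S) (`|xs ord0 i| / 2)).
have r0 : 0 < r.
  rewrite lt_min r10 lt_bigmin// => i; rewrite SE => xi.
  by rewrite divr_gt0// normr_gt0.
have rS y i : `|y - xs| < r -> i \in S -> `|y ord0 i - xs ord0 i| < `|xs ord0 i| / 2.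
  move=> yr iS; apply: le_lt_trans (coord_dist_le_mx_norm _ _ _ _) _.
  apply: lt_le_trans yr _; rewrite ge_min; apply/orP; right.
  exact: bigmin_le_cond.
have y0 y : `|y - xs| < r -> forall i, i \in S -> y ord0 i != 0.
  move=> yr i iS; apply/negP => /eqP yi0; have := rS y i yr iS.
  rewrite yi0 sub0r normrN; have := normr_ge0 (xs ord0 i); lra.
have /choice[C HC] : forall i, exists C : R, 0 <= C /\ (i \in S -> forall s s',
   `|s - xs ord0 i| < `|xs ord0 i| / 2 -> `|s' - xs ord0 i| < `|xs ord0 i| / 2 ->
    `|dabspow q s - dabspow q s'| <= C * `|s - s'|).
  move=> i; case iS: (i \in S); last by exists 0.
  have xi : xs ord0 i != 0 by rewrite -SE.
  by have [C [C0 H]] := dabspow_lipschitz q_lt1 xi; exists C.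
have C0 i : 0 <= C i by have [] := HC i.
have lC0 : 0 <= lambda * \sum_i C i.
  by apply: mulr_ge0; [exact: ltW|exact: sumr_ge0].
exists r, (L + lambda * \sum_i C i); split => //; first exact: addr_ge0.
move=> y z yr zr.
rewrite (proj2 (Epart_differentiable (y0 y yr) (df y))).
rewrite (proj2 (Epart_differentiable (y0 z zr) (df z))).
rewrite /grad_Epart opprD addrACA mulrDl; apply: (le_trans (ler_normD _ _)).
rewrite lerD//.
  by apply: lipf; [move: yr|move: zr]; rewrite lt_min => /andP[].
apply/mx_norm_leP => [|i j]; first exact: mulr_ge0.
rewrite (ord1 i) !mxE; case: ifP => jS; last first.
  by rewrite subrr normr0 mulr_ge0.
rewrite -mulrBr normrM (gtr0_norm lambda_gt0) -mulrA; apply: ler_wpM2l; first exact: ltW.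
have [_ /(_ jS) H] := HC j; apply: (le_trans (H _ _ _ _)); [exact: rS|exact: rS|].
apply: ler_pM => //; last exact: coord_dist_le_mx_norm.
by rewrite (bigD1 j)//= lerDl sumr_ge0.
Qed.

End Epart.

Lemma is_derive_square (R : realType) (K z t : R) :
  is_derive t (1 : R) (fun s => K * (s - z) ^+ 2) (K * (2 * (t - z))).
Proof.
apply: is_derive_eps => e e0.
have K1 : 0 < `|K| + 1 by rewrite ltr_wpDl.
exists (e / (`|K| + 1)); first by rewrite divr_gt0.
move=> s; rewrite ltr_pdivlMr// => sd.
rewrite (_ : _ - _ = K * s * s); last by ring.
rewrite !normrM ler_wpM2r// mulrC; apply: ltW; apply: le_lt_trans sd.
by rewrite ler_wpM2l// lerDl.
Qed.

Section SubspaceGrowth.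
Context {R : realType} {n : nat} (g : 'rV[R]_n -> R) (c : 'rV[R]_n) (r L : R)
  (V : set 'rV[R]_n).
Hypothesis r0 : 0 < r.
Hypothesis L0 : 0 <= L.
Hypothesis dg : forall y, `|y - c| < r -> differentiable g y.
Hypothesis lipg : forall y z, `|y - c| < r -> `|z - c| < r ->
  `|grad g y - grad g z| <= L * `|y - z|.
Hypothesis VZ : forall k v, V v -> V (k *: v).
Hypothesis Vclosed : closed V.
Hypothesis posH : forall H, gen_hess g c H -> forall v, V v -> v != 0 ->
  0 < dotv (v *m H) v.
Hypothesis crit : forall v, V v -> dotv (grad g c) v = 0.

(** Monotonicity of the gradient between [c] and [c + t *: v], with [c] critical along [V], bounds
    the slope of [g] along [v] below by [eta * t * |v|^2]. Subtracting the quadratic with half that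
    constant leaves a function with nonnegative derivative on the open unit interval. *)
Lemma subspace_growth : exists eta rho : R, [/\ 0 < eta, 0 < rho &
  forall v, V v -> `|v| < rho -> g c + eta * `|v| ^+ 2 <= g (c + v)].
Proof.
have [eta [rho [eta0 rho0 rhor Hess]]] :=
  uniform_hess_bound r0 L0 lipg VZ Vclosed posH.
exists (eta / 2), rho; split => //; first by rewrite divr_gt0.
move=> v Vv vrho.
have dg' y : `|y - c| < rho -> differentiable g y.
  by move=> yr; apply: dg; exact: lt_le_trans rhor.
have lipg' y z : `|y - c| < rho -> `|z - c| < rho ->
    `|grad g y - grad g z| <= L * `|y - z|.
  by move=> yr zr; apply: lipg; exact: lt_le_trans rhor.
have tv (t : R) : 0 <= t -> t <= 1 -> `|t *: v| < rho.
  by move=> t0 t1; apply: le_lt_trans vrho; rewrite normrZ ger0_norm// ler_piMl.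
have dline (t : R) : 0 <= t -> t <= 1 ->
    is_derive t (1 : R) (fun s => g (c + s *: v)) (dotv (grad g (c + t *: v)) v).
  move=> t0 t1; apply: is_derive_line; apply: dg'.
  by rewrite [c + _]addrC addrK; exact: tv.
have dsq (t : R) : is_derive t (1 : R) (fun s : R => (eta / 2 * `|v| ^+ 2) * s ^+ 2)
    ((eta / 2 * `|v| ^+ 2) * (2 * t)).
  by have := is_derive_square (eta / 2 * `|v| ^+ 2) 0 t;
     rewrite subr0; under eq_fun do rewrite subr0.
have dphi (t : R) : 0 <= t -> t <= 1 -> is_derive t (1 : R)
    (fun s => g (c + s *: v) - (eta / 2 * `|v| ^+ 2) * s ^+ 2)
    (dotv (grad g (c + t *: v)) v - (eta / 2 * `|v| ^+ 2) * (2 * t)).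
  by move=> t0 t1; apply: is_deriveB; exact: dline.
have [||t] := @MVT R (fun s => g (c + s *: v) - (eta / 2 * `|v| ^+ 2) * s ^+ 2)
    (fun t => dotv (grad g (c + t *: v)) v - (eta / 2 * `|v| ^+ 2) * (2 * t)) 0 1 ltr01.
- by move=> t; rewrite in_itv/= => /andP[t0 t1]; apply: dphi; exact: ltW.
- apply: derivable_within_continuous => t; rewrite in_itv/= => /andP[t0 t1].
  by have [] := dphi t t0 t1.
rewrite in_itv/= => /andP[t0 t1].
rewrite scale1r scale0r addr0 expr1n mulr1 expr0n mulr0 !subr0 mulr1 => E.
have tvr := tv t (ltW t0) (ltW t1).
have cc : `|c - c| < rho by rewrite subrr normr0.
have ctv : `|c + t *: v - c| < rho by rewrite [c + _]addrC addrK.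
have := hess_monotone L0 dg' lipg'
  (fun z zr tz => Hess z (t *: v) zr tz (VZ _ Vv)) cc ctv.
rewrite dotvBl crit ?subr0; last exact: VZ.
rewrite dotvZr normrZ (gtr0_norm t0) exprMn => H.
have : eta * (t * `|v| ^+ 2) <= dotv (grad g (c + t *: v)) v.
  by rewrite -(ler_pM2l t0); move: H; rewrite expr2; lra.
by move: E; lra.
Qed.

End SubspaceGrowth.

Lemma is_derive_min (R : realType) (u : R -> R) (t d : R) :
  is_derive t (1 : R) u d -> (forall s, u t <= u s) -> d = 0.
Proof.
move=> du umin; apply/eqP; rewrite -normr_eq0 eq_le normr_ge0 andbT.
apply/ler_addgt0Pr => e e0; rewrite add0r.
have [dl dl0 H] := is_derive_epsP du e0.
pose s := dl / 2; have s0 : 0 < s by rewrite divr_gt0.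
have sd : s < dl by rewrite /s; lra.
have := H s; rewrite gtr0_norm// => /(_ sd).
have := H (- s); rewrite normrN gtr0_norm// => /(_ sd).
have := umin (t + s); have := umin (t + - s).
rewrite !ler_norml => h1 h2 /andP[h3 h4] /andP[h5 h6].
by apply/andP; split; rewrite -(ler_pM2l s0); lra.
Qed.

Section LocalGrowth.
Context {R : realType} {n : nat} (f : 'rV[R]_n -> R) (lambda q alpha : R).
Hypothesis lambda_gt0 : 0 < lambda.
Hypothesis q_ge0 : 0 <= q.
Hypothesis q_lt1 : q < 1.
Hypothesis alpha_gt0 : 0 < alpha.

(** The prox objective is a sum over coordinates, so changing a single entry of the minimizer
    isolates one summand. *)
Lemma prox_coord (x w : 'rV[R]_n) : prox_point f lambda q alpha x w ->
  forall i s, 2^-1 * ((x - alpha *: grad f x) ord0 i - w ord0 i) ^+ 2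
      + alpha * lambda * abspow q (w ord0 i)
   <= 2^-1 * ((x - alpha *: grad f x) ord0 i - s) ^+ 2
      + alpha * lambda * abspow q s.
Proof.
set z := x - _ => Hprox i s.
pose v : 'rV[R]_n := \row_j (if j == i then s else w ord0 j).
have := Hprox v; rewrite /= !enorm_sqr /lqq.
rewrite !(bigD1 (P := predT) i)//= !mxE eqxx.
rewrite [X in _ <= _ * (_ + X) + _](eq_bigr (fun j => (z - w) ord0 j ^+ 2)); last first.
  by move=> j ji; rewrite !mxE (negbTE ji).
rewrite [X in _ <= _ + _ * (_ + X)](eq_bigr (fun j => abspow q (w ord0 j))); last first.
  by move=> j ji; rewrite !mxE (negbTE ji).
by lra.
Qed.

(** At a nonzero entry the scalar prox objective is differentiable, and its derivative at the
    minimizer is [alpha] times the corresponding entry of the gradient of [Epart]. *)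
Lemma P_stationary_grad (xs : 'rV[R]_n) : P_stationary f lambda q alpha xs ->
  forall i, i \in supp xs -> grad_Epart f lambda q (supp xs) xs ord0 i = 0.
Proof.
move=> Pxs i iS; have xi : xs ord0 i != 0 by move: iS; rewrite inE.
have H := prox_coord Pxs i.
set z := (xs - alpha *: grad f xs) ord0 i in H.
have zE : z = xs ord0 i - alpha * grad f xs ord0 i by rewrite /z !mxE.
pose u s := 2^-1 * (z - s) ^+ 2 + alpha * lambda * abspow q s.
have du : is_derive (xs ord0 i) (1 : R) u
    (- (z - xs ord0 i) + alpha * lambda * dabspow q (xs ord0 i)).
  apply: is_deriveD; last exact: (is_deriveZ _ (is_derive_abspow q xi)).
  have -> : - (z - xs ord0 i) = 2^-1 * (2 * (xs ord0 i - z)) by field.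
  have := is_derive_square 2^-1 z (xs ord0 i).
  by under eq_fun do rewrite -sqrrN opprB.
have := is_derive_min du H; rewrite zE /grad_Epart !mxE iS.
set D := dabspow _ _; set G := 'D_ _ f xs => h.
have : alpha * (G + lambda * D) = 0 by lra.
by move/eqP; rewrite mulf_eq0 gt_eqF//= => /eqP.
Qed.

Lemma quad_submx (S : {set 'I_n}) (H : 'M[R]_n) (v : 'rV[R]_n) :
  (forall i, i \notin S -> v ord0 i = 0) ->
  dotv (subv S v *m principal_submx S H) (subv S v) = dotv (v *m H) v.
Proof.
move=> v0; rewrite /dotv [RHS](bigID (mem S))/= [X in _ + X]big1 ?addr0; last first.
  by move=> i iS; rewrite v0// mulr0.
rewrite [RHS]big_enum_val; apply: eq_bigr => a _; rewrite !mxE; congr (_ * _).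
rewrite [RHS](bigID (mem S))/= [X in _ + X]big1 ?addr0; last first.
  by move=> i iS; rewrite v0// mul0r.
by rewrite [RHS]big_enum_val; apply: eq_bigr => b _; rewrite !mxE.
Qed.

(** Split [y = xs + v + u] into a displacement [v] on the support and [u] off it. Second-order
    growth of [Epart] handles [v]; for [u] the penalty outweighs the change of [f]. *)
Lemma local_growth (xs : 'rV[R]_n) (r1 L : R) : 0 < r1 -> 0 <= L ->
  (forall y, differentiable f y) ->
  (forall y z, `|y - xs| < r1 -> `|z - xs| < r1 ->
     `|grad f y - grad f z| <= L * `|y - z|) ->
  P_stationary f lambda q alpha xs ->
  (forall M, hessE f lambda q xs M ->
      forall v : 'rV[R]_#|supp xs|, v != 0 -> 0 < dotv (v *m M) v) ->
  unique_local_minimizer f lambda q xs.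
Proof.
move=> r10 L0 df lipf Pxs posM; set S := supp xs.
pose V : set 'rV[R]_n := [set v | forall i, i \notin S -> v ord0 i = 0].
have [r [L' [r0 L'0 yS lipE]]] := Epart_LC1 lambda_gt0 q_lt1 r10 L0 df lipf.
have dE y : `|y - xs| < r -> differentiable (Epart f lambda q S) y.
  by move=> yr; exact: (proj1 (Epart_differentiable q lambda_gt0 (yS y yr) (df y))).
have VZ k v : V v -> V (k *: v) by move=> Vv i iS; rewrite mxE Vv// mulr0.
have Vclosed : closed V.
  have -> : V = \bigcap_(i in [set i | i \notin S]) [set v : 'rV[R]_n | v ord0 i = 0].
    by apply/seteqP; split => v /= H i iS; exact: H.
  apply: closed_bigI => i _.
  apply: (preimage_closed _ (@closed_eq R 0)) => v _; exact: coord_continuous.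
have posH H : gen_hess (Epart f lambda q S) xs H -> forall v, V v -> v != 0 ->
    0 < dotv (v *m H) v.
  move=> HH v Vv v0; rewrite -(quad_submx H Vv); apply: posM; first by exists H.
  apply: contra v0 => /eqP sv0; apply/eqP/rowP => i; rewrite mxE.
  have [iS|iS] := boolP (i \in S); last exact: Vv.
  move/rowP: sv0 => /(_ (enum_rank_in iS i)); rewrite !mxE.
  by rewrite enum_rankK_in.
have crit v : V v -> dotv (grad (Epart f lambda q S) xs) v = 0.
  move=> Vv; have xr : `|xs - xs| < r by rewrite subrr normr0.
  rewrite (proj2 (Epart_differentiable q lambda_gt0 (yS xs xr) (df xs))).
  apply: big1 => i _; have [iS|iS] := boolP (i \in S); last by rewrite Vv// mulr0.
  by rewrite P_stationary_grad// mul0r.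
have [eta [rho [eta0 rho0 grow]]] := subspace_growth r0 L'0 dE lipE VZ Vclosed posH crit.
(* An upper bound for the max norm of [grad f] on the ball of radius [r1]. *)
pose C := n%:R * (`|grad f xs| + L * r1).
have C0 : 0 <= C by rewrite mulr_ge0// addr_ge0// mulr_ge0// ltW.
have C1 : 0 < C + 1 by rewrite ltr_wpDl.
(* The penalty is made to exceed [(C + 1) * |t|]: [C] pays for the change of [f], and the extra 1
   for the quadratic term off the support. *)
have a0 : 0 < lambda / (C + 1) by rewrite divr_gt0.
have [d d0 dom] := abspow_dominates q_lt1 a0.
(* The bound 1 serves the part off the support; the divisor [n + 1] absorbs the factor [n] between
   the squared Euclidean and maximum norms. *)
pose eta' := Num.min 1 (eta / (n%:R + 1)).
have n1 : 0 < n%:R + 1 :> R by rewrite ltr_wpDl.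
have eta'0 : 0 < eta' by rewrite lt_min ltr01 divr_gt0.
exists eta' => //.
(* Here [rho] serves the growth on the support, [d] the domination by the penalty, [r1] the gradient
   bound, and 1 makes squares of entries at most their absolute values. *)
apply/nbhs_ballP; exists (Num.min (Num.min rho d) (Num.min r1 1)).
  by rewrite /= !lt_min rho0 d0 r10 ltr01.
move=> y; rewrite -ball_normE /ball_ /= distrC !lt_min.
move=> /andP[/andP[yrho yd] /andP[yr1 y1]].
have xsS i : i \notin S -> xs ord0 i = 0 by rewrite inE negbK => /eqP.
pose v : 'rV[R]_n := \row_i (if i \in S then (y - xs) ord0 i else 0).
pose u : 'rV[R]_n := \row_i (if i \in S then 0 else y ord0 i).
have yE : y = xs + v + u.
  apply/rowP => i; rewrite !mxE; case: ifPn => iS; first by ring.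
  by rewrite xsS// addr0 add0r.
have Vv : V v by move=> i iS; rewrite mxE (negbTE iS).
have vn : `|v| <= `|y - xs|.
  apply/mx_norm_leP => // i j; rewrite (ord1 i) mxE; case: ifP => _.
    exact: coord_le_mx_norm.
  by rewrite normr0.
have un : `|u| <= `|y - xs|.
  apply/mx_norm_leP => // i j; rewrite (ord1 i) mxE; case: ifPn => jS.
    by rewrite normr0.
  by have := coord_dist_le_mx_norm y xs ord0 j; rewrite xsS// subr0.
have tun (t : R) : 0 <= t -> t <= 1 -> `|xs + v + t *: u - xs| <= `|y - xs|.
  move=> t0 t1; apply/mx_norm_leP => // i j; rewrite (ord1 i) !mxE.
  case: ifPn => jS.
    rewrite (_ : _ - _ = (y - xs) ord0 j); first exact: coord_le_mx_norm.
    by rewrite !mxE; ring.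
  rewrite (_ : _ - _ = t * (y ord0 j - xs ord0 j)); last first.
    by rewrite xsS//; ring.
  rewrite normrM ger0_norm//; apply: (@le_trans _ _ (1 * `|y ord0 j - xs ord0 j|)).
    by rewrite ler_wpM2r.
  by rewrite mul1r coord_dist_le_mx_norm.
have [t [t0 t1 fE]] := mvt_line (c := xs + v) (v := u)
  (fun t _ _ => df (xs + v + t *: u)).
pose U := \sum_(i | i \notin S) `|y ord0 i|.
have uU : \sum_(i < n) `|u ord0 i| = U.
  rewrite (bigID (mem S))/= big1 ?add0r; last by move=> i iS; rewrite mxE iS normr0.
  by apply: eq_bigr => i iS; rewrite mxE (negbTE iS).
have fbound : - (C * U) <= f y - f (xs + v).
  rewrite yE fE lerNl; apply: (le_trans (ler_norm _)); rewrite normrN dotvC.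
  apply: (le_trans (dotv_bound _ _)); rewrite uU mulrC.
  apply: ler_wpM2r; first exact: sumr_ge0.
  set z := xs + v + t *: u.
  have zr : `|z - xs| < r1 by apply: le_lt_trans yr1; apply: tun; exact: ltW.
  have xr : `|xs - xs| < r1 by rewrite subrr normr0.
  have gz : `|grad f z| <= `|grad f xs| + L * r1.
    rewrite -[grad f z](subrK (grad f xs)) addrC; apply: (le_trans (ler_normD _ _)).
    rewrite lerD2l; apply: (le_trans (lipf _ _ zr xr)).
    by rewrite ler_wpM2l// ltW.
  rewrite /C; have [n0|n0] := posnP n.
    have -> : grad f z = 0 by apply/rowP => i; have := ltn_ord i; rewrite {2}n0.
    by rewrite normr0 mulr_ge0// addr_ge0// mulr_ge0// ltW.
  apply: (le_trans gz); rewrite ler_peMl//; last by rewrite ler1n.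
  by rewrite addr_ge0// mulr_ge0// ltW.
have reg : (C + 1) * U <= lambda * \sum_(i | i \notin S) abspow q (y ord0 i).
  rewrite !mulr_sumr; apply: ler_sum => i iS.
  have yi : `|y ord0 i| < d.
    apply: le_lt_trans yd; have := coord_dist_le_mx_norm y xs ord0 i.
    by rewrite xsS// subr0.
  have -> : lambda * abspow q (y ord0 i) =
      (C + 1) * (lambda / (C + 1) * abspow q (y ord0 i)) by field; rewrite gt_eqF.
  by rewrite ler_pM2l//; exact: dom.
have Ey : Epart f lambda q S y - Epart f lambda q S (xs + v) = f y - f (xs + v).
  rewrite /Epart !lqq_subv.
  rewrite [X in f y + _ * X - _](eq_bigr (fun i => abspow q ((xs + v) ord0 i))); last first.
    by move=> i iS; rewrite {1}yE [X in abspow q X]mxE [X in _ + X]mxE iS addr0.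
  by ring.
have Gv := grow v Vv (le_lt_trans vn yrho).
have yU : enorm (y - xs) ^+ 2 <= n%:R * `|v| ^+ 2 + U.
  rewrite enorm_sqr (bigID (mem S))/=; apply: lerD.
    apply: (@le_trans _ _ (enorm v ^+ 2)); last exact: enorm_sqr_le.
    rewrite enorm_sqr [leRHS](bigID (mem S))/= ler_wpDr//.
      by apply: sumr_ge0 => i _; rewrite sqr_ge0.
    by apply: ler_sum => i iS; rewrite [v ord0 i]mxE iS.
  apply: ler_sum => i iS; rewrite !mxE xsS// subr0.
  have yi1 : `|y ord0 i| <= 1.
    apply: ltW; apply: le_lt_trans y1; have := coord_dist_le_mx_norm y xs ord0 i.
    by rewrite xsS// subr0.
  by rewrite -[leLHS]ger0_norm ?sqr_ge0// normrX expr2 ler_piMl.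
have U0 : 0 <= U by apply: sumr_ge0.
have v20 : 0 <= `|v| ^+ 2 by rewrite sqr_ge0.
have B1 : eta' * (n%:R * `|v| ^+ 2) <= eta * `|v| ^+ 2.
  rewrite mulrA; apply: ler_wpM2r => //.
  apply: (@le_trans _ _ (eta / (n%:R + 1) * n%:R)).
    by apply: ler_wpM2r => //; rewrite ge_min lexx orbT.
  rewrite -mulrA [X in eta * X]mulrC; apply: ler_piMr; first exact: ltW.
  by rewrite ler_pdivrMr// mul1r lerDl.
have B2 : eta' * U <= U by apply: ler_piMl => //; rewrite ge_min lexx.
have B3 : eta' * enorm (y - xs) ^+ 2 <= eta' * (n%:R * `|v| ^+ 2 + U).
  by apply: ler_wpM2l yU; exact: ltW.
rewrite (Fobj_Epart f lambda q xsS) (FobjE f lambda q S y).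
move: Gv fbound reg; rewrite -Ey; lra.
Qed.

End LocalGrowth.

(** * The iterates *)

Lemma nonincreasing_small_gap (R : realType) (a : nat -> R) (m : R) :
  (forall k, a k.+1 <= a k) -> (forall k, m <= a k) ->
  forall e, 0 < e -> exists K, forall k, (K <= k)%N -> a k - a k.+1 < e.
Proof.
move=> na ma e e0.
have anti k l : (k <= l)%N -> a l <= a k.
  move=> kl; rewrite -(subnK kl); elim: (l - k)%N => [|j IH]; first by rewrite add0n.
  by rewrite addSn; exact: le_trans (na _) IH.
have hinf : has_inf (range a).
  split; first by exists (a 0%N), 0%N.
  by exists m => _ [k _ <-].
have [_ [K _ <-] aK] := inf_adherent e0 hinf.
exists K => k Kk; have h1 := anti _ _ Kk.
have h2 : inf (range a) <= a k.+1 by apply: ge_inf; [exact: hinf.2|exists k.+1].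
by lra.
Qed.

Lemma clusterP (R : realType) n (x : nat -> 'rV[R]_n) xs :
  cluster (x @ \oo) xs ->
  forall (e : R) N, 0 < e -> exists k, (N <= k)%N /\ `|x k - xs| < e.
Proof.
move=> cl e N e0.
have Am : (x @ \oo) (x @` [set k | (N <= k)%N]).
  by exists N => // k Nk; exists k.
have [z [[k Nk <-] zl]] := cl _ _ Am (nbhsx_ballx xs _ e0).
by exists k; split => //; move: zl; rewrite -ball_normE /ball_ /= distrC.
Qed.

Section Step.
Context {R : realType} {n : nat} (f : 'rV[R]_n -> R) (lambda q sigma gamma alpha : R).

(** The fallback [x' = w] satisfies the same inequality trivially, and a Newton direction vanishes
    off the support of [w], so no entry is created. *)
Lemma newton_step_descent (w x' : 'rV[R]_n) :
  newton_step f lambda q sigma gamma w x' ->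
  Fobj f lambda q x' <= Fobj f lambda q w - sigma / 2 * enorm (x' - w) ^+ 2 /\
  (forall i, w ord0 i = 0 -> x' ord0 i = 0).
Proof.
have stay : Fobj f lambda q w <= Fobj f lambda q w - sigma / 2 * enorm (w - w) ^+ 2.
  by rewrite subrr enorm_sqr big1 ?mulr0 ?subr0// => i _; rewrite mxE expr0n.
move=> [M _ [[_ ->]//|[d [_ d0] [[_ ->]//|[s Hs ->]]]]]; split.
  have -> : w - gamma ^ s *: d - w = - (gamma ^ s *: d) by rewrite addrAC subrr add0r.
  by rewrite enormN.
move=> i wi; rewrite !mxE wi.
have iS : i \in (~: supp w)%SET by rewrite !inE wi eqxx.
move/rowP: d0 => /(_ (enum_rank_in iS i)); rewrite !mxE enum_rankK_in// => ->.
by rewrite mulr0 subr0.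
Qed.

(** PSNP and PCSNP enter the convergence argument only through these facts, so both are treated at
    once. *)
Lemma generated_steps (x0 : 'rV[R]_n) (w x : nat -> 'rV[R]_n) :
  0 < sigma ->
  PSNP f lambda q sigma gamma (fun=> alpha) x0 w x \/
  PCSNP f lambda q sigma gamma (fun=> alpha) x0 w x ->
  x 0%N = x0 /\ forall k, [/\ prox_step f lambda q sigma alpha (x k) (w k),
    Fobj f lambda q (x k.+1) <=
      Fobj f lambda q (w k) - sigma / 2 * enorm (x k.+1 - w k) ^+ 2 &
    forall i, w k ord0 i = 0 -> x k.+1 ord0 i = 0].
Proof.
move=> sigma0 [[x00 H]|[x00 H]]; split=> // k; have [pk nk] := H k.
  by have [? ?] := newton_step_descent nk.
move: nk; case: ifP => _ nk; first by have [? ?] := newton_step_descent nk.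
rewrite nk; split => //.
by rewrite subrr enorm_sqr big1 ?mulr0 ?subr0// => i _; rewrite mxE expr0n.
Qed.

End Step.

Section Iterates.
Context {R : realType} {n : nat} (f : 'rV[R]_n -> R) (lambda q sigma alpha : R).
Context (w x : nat -> 'rV[R]_n) (xs : 'rV[R]_n) (fmin : R).
Hypothesis df : forall y, differentiable f y.
Hypothesis f_ge : forall y, fmin <= f y.
Hypothesis lambda_gt0 : 0 < lambda.
Hypothesis q_ge0 : 0 <= q.
Hypothesis q_lt1 : q < 1.
Hypothesis sigma_gt0 : 0 < sigma.
Hypothesis alpha_gt0 : 0 < alpha.
Hypothesis prox_x : forall k, prox_point f lambda q alpha (x k) (w k).
Hypothesis descent_w : forall k, Fobj f lambda q (w k) <=
  Fobj f lambda q (x k) - sigma / 4 * enorm (w k - x k) ^+ 2.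
Hypothesis descent_x : forall k, Fobj f lambda q (x k.+1) <=
  Fobj f lambda q (w k) - sigma / 2 * enorm (x k.+1 - w k) ^+ 2.
Hypothesis supp_x : forall k i, w k ord0 i = 0 -> x k.+1 ord0 i = 0.
Hypothesis xs_acc : forall (e : R) N, 0 < e -> exists k, (N <= k)%N /\ `|x k - xs| < e.

Let F := Fobj f lambda q.

Lemma lqq_ge0 (y : 'rV[R]_n) : 0 <= lqq q y.
Proof. by apply: sumr_ge0 => i _; exact: abspow_ge0. Qed.

Lemma Fobj_ge y : fmin <= F y.
Proof.
apply: (le_trans (f_ge y)); rewrite lerDl; apply: mulr_ge0; first exact: ltW.
exact: lqq_ge0.
Qed.

Lemma descent_step k : F (x k.+1) <= F (x k) -
  (sigma / 4 * enorm (w k - x k) ^+ 2 + sigma / 2 * enorm (x k.+1 - w k) ^+ 2).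
Proof. by have := descent_w k; have := descent_x k; rewrite -/F; lra. Qed.

Lemma Fobj_nonincreasing k l : (k <= l)%N -> F (x l) <= F (x k).
Proof.
move=> kl; rewrite -(subnK kl); elim: (l - k)%N => [|j IH]; first by rewrite add0n.
rewrite addSn; apply: le_trans IH; apply: (le_trans (descent_step _)).
have s4 : 0 <= sigma / 4 by rewrite divr_ge0// ltW.
have s2 : 0 <= sigma / 2 by rewrite divr_ge0// ltW.
by rewrite gerBl addr_ge0// mulr_ge0// sqr_ge0.
Qed.

Lemma small_steps e : 0 < e -> exists K, forall k, (K <= k)%N ->
  `|w k - x k| < e /\ `|x k.+1 - w k| < e.
Proof.
move=> e0; have d0 : 0 < sigma / 4 * e ^+ 2 by rewrite mulr_gt0 ?exprn_gt0// divr_gt0.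
have [K HK] := nonincreasing_small_gap (fun k => Fobj_nonincreasing (leqnSn k))
  (fun k => Fobj_ge (x k)) d0.
exists K => k Kk; have := HK k Kk; have := descent_step k.
have h1 := sqr_ge0 (enorm (w k - x k)); have h2 := sqr_ge0 (enorm (x k.+1 - w k)).
have p1 := mulr_ge0 (ltW sigma_gt0) h1; have p2 := mulr_ge0 (ltW sigma_gt0) h2.
move=> g1 g2; have small (u : 'rV[R]_n) : sigma * enorm u ^+ 2 < sigma * e ^+ 2 -> `|u| < e.
  rewrite ltr_pM2l// => ue; apply: le_lt_trans (mx_norm_le_enorm u) _.
  by rewrite -(@ltr_pXn2r _ 2) ?nnegrE ?enorm_ge0// ltW.
by split; apply: small; lra.
Qed.

Lemma support_identification : exists k0 : nat, forall k, (k0 <= k)%N ->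
  supp (w k) = supp (x k) /\ supp (x k) = supp xs.
Proof.
have al0 : 0 < alpha * lambda by rewrite mulr_gt0.
have [c c0 gap] := abspow_prox_gap q_lt1 al0.
have wgap k i : w k ord0 i != 0 -> c <= `|w k ord0 i|.
  by apply: gap; exact: prox_coord (prox_x k) i.
(* Two consecutive moves of less than [c / 3] stay below the gap [c], so an entry of [w] can neither
   appear nor vanish; the same margin compares [w k], [x k] and [xs]. *)
have c30 : 0 < c / 3 by rewrite divr_gt0.
have [K HK] := small_steps c30.
have wx k i : (K <= k)%N -> `|w k ord0 i - x k ord0 i| < c / 3.
  by move=> /HK[h _]; exact: le_lt_trans (coord_dist_le_mx_norm _ _ _ _) h.
have xw k i : (K <= k)%N -> `|x k.+1 ord0 i - w k ord0 i| < c / 3.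
  by move=> /HK[_ h]; exact: le_lt_trans (coord_dist_le_mx_norm _ _ _ _) h.
have wSw k i : (K <= k)%N -> (w k.+1 ord0 i == 0) = (w k ord0 i == 0).
  move=> Kk; have h1 := xw k i Kk; have h2 := wx k.+1 i (leqW Kk).
  have h : `|w k.+1 ord0 i - w k ord0 i| < c.
    rewrite (_ : _ - _ = (w k.+1 ord0 i - x k.+1 ord0 i) + (x k.+1 ord0 i - w k ord0 i)).
      by apply: (le_lt_trans (ler_normD _ _)); lra.
    by ring.
  apply/idP/idP => /eqP z; move: h; rewrite z ?sub0r ?subr0 ?normrN => h;
    by apply: contraLR h => /wgap; rewrite -leNgt.
have xSw k i : (K <= k)%N -> (x k.+1 ord0 i == 0) = (w k ord0 i == 0).
  move=> Kk; apply/idP/idP => [/eqP z|/eqP z]; last by rewrite supp_x.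
  have := xw k i Kk; rewrite z sub0r normrN => h.
  by apply: contraLR h => /wgap h'; rewrite -leNgt; lra.
have wK k i : (K <= k)%N -> (w k ord0 i == 0) = (w K ord0 i == 0).
  move=> Kk; rewrite -(subnK Kk); elim: (k - K)%N => [|j IH]; first by rewrite add0n.
  by rewrite addSn wSw ?leq_addl.
have xK k i : (K < k)%N -> (x k ord0 i == 0) = (w K ord0 i == 0).
  by case: k => // k Kk; rewrite xSw// wK.
have sK i : (xs ord0 i == 0) = (w K ord0 i == 0).
  have [w0|w0] := eqVneq (w K ord0 i) 0.
    apply/normr0P/eqP; rewrite eq_le normr_ge0 andbT.
    apply/ler_addgt0Pr => e e0; rewrite add0r.
    have [k [Kk xk]] := xs_acc K.+1 e0.
    have xk0 : x k ord0 i = 0 by apply/eqP; rewrite xK// w0 eqxx.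
    have := coord_dist_le_mx_norm (x k) xs ord0 i; rewrite xk0 sub0r normrN => h.
    by apply: ltW; exact: le_lt_trans xk.
  apply/negbTE/negP => /eqP xs0.
  have [k [Kk xk]] := xs_acc K.+1 c30.
  have h1 := coord_dist_le_mx_norm (x k) xs ord0 i.
  have h2 := wx k i (ltnW Kk).
  have h3 : c <= `|w k ord0 i| by apply: wgap; rewrite wK// ltnW.
  move: h1; rewrite xs0 subr0 => h1.
  have := ler_normD (w k ord0 i - x k ord0 i) (x k ord0 i); rewrite subrK.
  by lra.
exists K.+1 => k Kk; split; apply/setP => i; rewrite !inE.
  by rewrite wK ?xK// ltnW.
by rewrite xK// sK.
Qed.

(** For [q = 0] the value of [F] jumps when a zero entry of [xs] becomes nonzero. With such entries
    frozen, [F] is [Epart], which is differentiable at [xs]. *)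
Lemma Fobj_continuous_on_support e : 0 < e -> exists2 d : R, 0 < d &
  forall y, `|y - xs| < d -> (forall i, xs ord0 i = 0 -> y ord0 i = 0) ->
    `|F y - F xs| < e.
Proof.
move=> e0; pose S := supp xs.
have xsS i : i \in S -> xs ord0 i != 0 by rewrite inE.
have [dE _] := Epart_differentiable q lambda_gt0 xsS (df xs).
have /(@cvgrPdist_lt _ _ _ (nbhs xs)) /(_ e e0) /nbhs_ballP[d /= d0 Hd] :=
  differentiable_continuous dE.
exists d => // y yd y0; rewrite /F !(@Fobj_Epart _ _ _ _ _ S).
- by rewrite distrC; apply: Hd; rewrite -ball_normE /ball_ /= distrC.
- by move=> i; rewrite inE negbK => /eqP.
- by move=> i; rewrite inE negbK => /eqP; exact: y0.
Qed.

(** One late iterate close to [xs] has value close to [F xs], and monotonicity hands the bound on to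
    all later iterates. *)
Lemma Fobj_lim e : 0 < e -> exists K, forall k, (K <= k)%N -> F (x k) < F xs + e.
Proof.
move=> e0; have [k0 Hk0] := support_identification.
have [d d0 Hd] := Fobj_continuous_on_support e0.
have [K [Kk xK]] := xs_acc k0 d0.
exists K => k /Fobj_nonincreasing /le_lt_trans; apply.
have : `|F (x K) - F xs| < e.
  apply: Hd => // i xi; apply/eqP; apply: contraTT (isT) => xKi.
  have [_ /setP /(_ i)] := Hk0 K Kk; rewrite !inE xi eqxx xKi//.
by rewrite ltr_norml => /andP[_]; lra.
Qed.

(** Places [xs] in the sublevel set of the initial point: iterates beyond [N] come close to [xs]
    with its support, where [F] is continuous. *)
Lemma Fobj_acc_le N : F xs <= F (x N).
Proof.
apply/ler_addgt0Pr => e e0; have [k0 Hk0] := support_identification.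
have [d d0 Hd] := Fobj_continuous_on_support e0.
have [K [Kk xK]] := xs_acc (maxn k0 N) d0.
have : `|F (x K) - F xs| < e.
  apply: Hd => // i xi; apply/eqP; apply: contraTT (isT) => xKi.
  have [|_ /setP /(_ i)] := Hk0 K; first exact: leq_trans (leq_maxl _ _) Kk.
  by rewrite !inE xi eqxx xKi.
have : F (x K) <= F (x N).
  by apply: Fobj_nonincreasing; exact: leq_trans (leq_maxr _ _) Kk.
by rewrite ltr_norml => h /andP[h' _]; lra.
Qed.

(** Induction from an iterate within [e' <= r / 2] of [xs]: two moves below [r / 4] keep the next
    one within [r], where growth and the value bound [F xs + eta * e'^2] bring it back within
    [e']. *)
Lemma iterates_converge (eta : R) : 0 < eta ->
  (\forall y \near xs, F xs + eta * enorm (y - xs) ^+ 2 <= F y) ->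
  x @ \oo --> xs.
Proof.
move=> eta0 /nbhs_ballP[r /= r0 grow].
apply/(@cvgrPdist_lt _ 'rV[R]_n) => e e0.
pose e' := Num.min e (r / 2).
have r20 : 0 < r / 2 by rewrite divr_gt0.
have e'0 : 0 < e' by rewrite lt_min e0.
have r40 : 0 < r / 4 by rewrite divr_gt0.
have [K1 HK1] := small_steps r40.
have ee0 : 0 < eta * e' ^+ 2 by rewrite mulr_gt0// exprn_gt0.
have [K2 HK2] := Fobj_lim ee0.
have [k1 [Kk1 xk1]] := xs_acc (maxn K1 K2) e'0.
exists k1 => // k /= k1k; rewrite distrC.
suff H : `|x k - xs| < e' by apply: lt_le_trans H _; rewrite ge_min lexx.
rewrite -(subnK k1k); elim: (k - k1)%N => [|j IH]; first by rewrite add0n.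
rewrite addSn; set m := (j + k1)%N in IH *.
have mk1 : (k1 <= m)%N by exact: leq_addl.
have mK1 : (K1 <= m)%N by apply: leq_trans mk1; apply: leq_trans Kk1; exact: leq_maxl.
have mK2 : (K2 <= m.+1)%N.
  by apply: leqW; apply: leq_trans mk1; apply: leq_trans Kk1; exact: leq_maxr.
have [s1 s2] := HK1 m mK1.
have inr : `|x m.+1 - xs| < r.
  rewrite (_ : _ - _ = (x m.+1 - w m) + ((w m - x m) + (x m - xs))); last first.
    by rewrite addrA !subrKA.
  have e'r : e' <= r / 2 by rewrite ge_min lexx orbT.
  apply: (le_lt_trans (ler_normD _ _)).
  have := ler_normD (w m - x m) (x m - xs); lra.
have := grow (x m.+1); rewrite -ball_normE /ball_ /= distrC => /(_ inr).
have := HK2 _ mK2 => h1 h2.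
have : enorm (x m.+1 - xs) ^+ 2 < e' ^+ 2 by rewrite -(ltr_pM2l eta0); lra.
rewrite ltr_pXn2r ?nnegrE ?enorm_ge0 ?(ltW e'0)//.
by apply: le_lt_trans; exact: mx_norm_le_enorm.
Qed.

(** The prox inequality against a fixed [v] passes to the limit along indices where [x k] and [w k]
    both tend to [xs]. The delicate term is the penalty of [w k]: after support identification its
    summands at zero entries of [xs] are exactly 0, and the others converge by continuity. *)
Lemma acc_P_stationary : {for xs, continuous (grad f)} ->
  P_stationary f lambda q alpha xs.
Proof.
move=> cgrad v /=.
have [k0 Hk0] := support_identification.
have /choice[s Hs] : forall m, exists k,
    [/\ (k0 <= k)%N, `|x k - xs| < inv_nat m & `|w k - xs| < inv_nat m].
  move=> m; have m20 : 0 < inv_nat m / 2 :> R by rewrite divr_gt0 ?inv_nat_gt0.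
  have [K HK] := small_steps m20.
  have [k [Kk xk]] := xs_acc (maxn k0 K) m20.
  exists k; split; first exact: leq_trans (leq_maxl _ _) Kk.
    by have := inv_nat_gt0 (R := R) m; lra.
  have [wk _] := HK k (leq_trans (leq_maxr _ _) Kk).
  rewrite -(subrKA (x k)); apply: (le_lt_trans (ler_normD _ _)); lra.
have xc : (fun m => x (s m)) @ \oo --> xs.
  by apply: cvg_inv_nat => m; have [] := Hs m.
have wc : (fun m => w (s m)) @ \oo --> xs.
  by apply: cvg_inv_nat => m; have [] := Hs m.
have gc : (fun m => grad f (x (s m))) @ \oo --> grad f xs.
  exact: (@cvg_comp _ _ _ (fun m => x (s m)) (grad f) _ _ _ xc cgrad).
have zc : (fun m => x (s m) - alpha *: grad f (x (s m))) @ \oo --> xs - alpha *: grad f xs.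
  by apply: cvgB => //; exact: cvgZr.
have enc (u : nat -> 'rV[R]_n) l : u @ \oo --> l ->
    (fun m => enorm (u m) ^+ 2) @ \oo --> enorm l ^+ 2.
  move=> ul; apply: (@cvg_comp _ _ _ u (fun y => enorm y ^+ 2) _ _ _ ul).
  exact: enorm_sqr_continuous.
have lc : (fun m => lqq q (w (s m))) @ \oo --> lqq q xs.
  apply: cvg_big; first exact: add_continuous.
  move=> i _; have [xi|xi] := eqVneq (xs ord0 i) 0.
    rewrite xi abspow0 (_ : (fun m => abspow q (w (s m) ord0 i)) = (fun=> 0)).
      exact: cvg_cst.
    apply/funext => m; have [km _ _] := Hs m; have [/setP /(_ i) h1 /setP /(_ i) h2] := Hk0 _ km.
    move: h1; rewrite h2 !inE xi eqxx => /negbT; rewrite negbK => /eqP ->.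
    exact: abspow0.
  have ci : (fun m => w (s m) ord0 i) @ \oo --> xs ord0 i.
    apply: (@cvg_comp _ _ _ (fun m => w (s m)) (fun M : 'rV[R]_n => M ord0 i) _ _ _ wc).
    exact: coord_continuous.
  apply: (@cvg_comp _ _ _ (fun m => w (s m) ord0 i) (abspow q) _ _ _ ci).
  apply: differentiable_continuous; apply/derivable1_diffP.
  by have [] := is_derive_abspow q xi.
have affine (a b : R) (u u' : nat -> R) l l' : u @ \oo --> l -> u' @ \oo --> l' ->
    (fun m => a * u m + b * u' m) @ \oo --> a * l + b * l'.
  move=> ul ul'.
  apply: (@cvgD _ _ _ _ _ (fun m => a * u m) (fun m => b * u' m)).
    exact: (@cvgM _ _ _ _ (fun=> a) u _ _ (cvg_cst _) ul).
  exact: (@cvgM _ _ _ _ (fun=> b) u' _ _ (cvg_cst _) ul').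
pose Phi (y u : 'rV[R]_n) := 2^-1 * enorm (y - alpha *: grad f y - u) ^+ 2
  + alpha * lambda * lqq q u.
have c1 : (fun m => Phi (x (s m)) (w (s m))) @ \oo --> Phi xs xs.
  by apply: affine; [apply: enc; exact: cvgB zc wc|exact: lc].
have c2 : (fun m => Phi (x (s m)) v) @ \oo --> Phi xs v.
  by apply: affine; [apply: enc; exact: cvgB zc (cvg_cst v)|exact: cvg_cst].
by apply: (ler_cvg_to c1 c2); exists 0%N => // m _; exact: prox_x.
Qed.

End Iterates.

(** * Bounded sublevel sets and the ball N(0, c0) *)

Section Sublevel.
Context {R : realType} {n : nat} (f : 'rV[R]_n -> R) (lambda q tau fmin : R)
  (x0 : 'rV[R]_n).
Hypothesis df : forall y, differentiable f y.
Hypothesis cgrad : continuous (grad f).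
Hypothesis f_ge : forall y, fmin <= f y.
Hypothesis lambda_gt0 : 0 < lambda.
Hypothesis q_ge0 : 0 <= q.
Hypothesis tau_gt0 : 0 < tau.
Hypothesis f_coercive : q = 0 -> coercive f.

Lemma lqq_sublevel y : sublevel f lambda q x0 y ->
  lambda * lqq q y <= Fobj f lambda q x0 - fmin.
Proof. by rewrite /sublevel /= {1}/Fobj; have := f_ge y; lra. Qed.

(** For [q > 0] the lower bound of [f] caps the penalty and hence each entry; for [q = 0] the
    penalty only counts entries, and coercivity bounds them. *)
Lemma sublevel_bounded : exists2 B : R, 0 <= B &
  forall y, sublevel f lambda q x0 y -> `|y| <= B.
Proof.
have [q0|qN0] := eqVneq q 0.
  have [B HB] := f_coercive q0 (Fobj f lambda q x0 + 1).
  exists `|B| => // y ysub; apply: (le_trans (mx_norm_le_enorm y)).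
  apply: le_trans (ler_norm B); rewrite leNgt; apply/negP => /ltW /HB.
  move: ysub; rewrite /sublevel /= {1}/Fobj.
  by have := mulr_ge0 (ltW lambda_gt0) (lqq_ge0 q y); lra.
have q0 : 0 < q by rewrite lt_neqAle eq_sym qN0.
pose D := (Fobj f lambda q x0 - fmin) / lambda.
exists (D `^ q^-1); first exact: powR_ge0.
move=> y ysub; apply/mx_norm_leP => [|i j]; first exact: powR_ge0.
rewrite (ord1 i); have [->|yj] := eqVneq (y ord0 j) 0.
  by rewrite normr0 powR_ge0.
have yD : `|y ord0 j| `^ q <= D.
  rewrite /D ler_pdivlMr// mulrC; apply: le_trans (lqq_sublevel ysub).
  rewrite ler_pM2l// -abspowE// /lqq (bigD1 j)//= lerDl.
  by apply: sumr_ge0 => k _; exact: abspow_ge0.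
rewrite -[leLHS](@powRr1 R)// -(divff qN0) powRrM.
apply: ge0_ler_powR; rewrite ?nnegrE ?powR_ge0 ?invr_ge0//.
exact: le_trans (powR_ge0 _ _) yD.
Qed.

(** Guarantees that [c0] is a true supremum and not a default value. The gradient is bounded on the
    sublevel set because that set lies in a compact ball. *)
Lemma c0_has_ubound : has_ubound
  [set 5 * (enorm x ^+ 2 + tau ^+ 2 * enorm (grad f x) ^+ 2
     + tau * lambda * lqq q x) | x in sublevel f lambda q x0].
Proof.
have [B B0 HB] := sublevel_bounded.
pose K : set 'rV[R]_n := [set y | `|y| <= B].
have cK : compact K.
  apply: bounded_closed_compact.
    exists B; split; first exact: num_real.
    by move=> M BM z /= zB; exact: le_trans zB (ltW BM).
  apply: (preimage_closed _ (@closed_le R B)) => z _; exact: norm_continuous.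
have K0 : K !=set0 by exists 0; rewrite /K /= normr0.
have [c _ Hc] : exists2 c, c \in K & forall t, t \in K ->
    enorm (grad f t) ^+ 2 <= enorm (grad f c) ^+ 2.
  apply: (EVT_max_rV K0 cK); apply: continuous_subspaceT => y.
  apply: (@continuous_comp _ _ _ (grad f) (fun z => enorm z ^+ 2)); first exact: cgrad.
  exact: enorm_sqr_continuous.
exists (5 * (n%:R * B ^+ 2 + tau ^+ 2 * enorm (grad f c) ^+ 2
  + tau * (Fobj f lambda q x0 - fmin))).
move=> _ [y ysub <-]; rewrite ler_pM2l//; apply: lerD; first apply: lerD.
- apply: (le_trans (enorm_sqr_le y)); apply: ler_wpM2l => //.
  by rewrite ler_pXn2r ?nnegrE// HB.
- apply: ler_wpM2l; first exact: sqr_ge0.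
  by apply: Hc; rewrite inE; exact: HB.
- by rewrite -mulrA ler_pM2l//; exact: lqq_sublevel.
Qed.

(** The ball is open, so a strict inequality is required. For [y != 0] the factor 5 provides it; for
    [y = 0] the gradient term does, because [grad f 0] is nonzero. *)
Lemma sublevel_nball y : grad f 0 != 0 -> sublevel f lambda q x0 y ->
  nball 0 (c0 f lambda q tau x0) y.
Proof.
move=> g0 ysub; rewrite /nball /= sub0r enormN.
have sup_ge : 5 * (enorm y ^+ 2 + tau ^+ 2 * enorm (grad f y) ^+ 2
     + tau * lambda * lqq q y) <= c0 f lambda q tau x0.
  by apply: ub_le_sup; [exact: c0_has_ubound|exists y].
apply: lt_le_trans sup_ge.
have l0 : 0 <= tau * lambda * lqq q y.
  by rewrite !mulr_ge0 ?lqq_ge0// ltW.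
have e0 := sqr_ge0 (enorm y); have g20 := sqr_ge0 (enorm (grad f y)).
have tg0 : 0 <= tau ^+ 2 * enorm (grad f y) ^+ 2 by rewrite mulr_ge0// sqr_ge0.
have enorm_gt0 (z : 'rV[R]_n) : z != 0 -> 0 < enorm z ^+ 2.
  move=> z0; rewrite exprn_gt0//; apply: lt_le_trans (mx_norm_le_enorm z).
  by rewrite normr_gt0.
have [y0|yN0] := eqVneq y 0; last by have := enorm_gt0 _ yN0; lra.
have : 0 < tau ^+ 2 * enorm (grad f y) ^+ 2.
  by apply: mulr_gt0; [exact: exprn_gt0|apply: enorm_gt0; rewrite y0].
lra.
Qed.

Lemma LC1_near y : LC1_on f (nball 0 (c0 f lambda q tau x0)) ->
  nball 0 (c0 f lambda q tau x0) y ->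
  exists r L : R, [/\ 0 < r, 0 <= L & forall u v, `|u - y| < r -> `|v - y| < r ->
     `|grad f u - grad f v| <= L * `|u - v|].
Proof.
move=> [_ [L HL]] yc0; set c := c0 _ _ _ _ _ in HL yc0.
have nballE (z : 'rV[R]_n) : nball 0 c z = (enorm z ^+ 2 < c) :> Prop.
  by rewrite /nball /= sub0r enormN.
rewrite nballE in yc0.
have /nbhs_ballP[r /= r0 Hr] : nbhs y [set z : 'rV[R]_n | enorm z ^+ 2 < c].
  have near_c : nbhs (enorm y ^+ 2) [set t | t < c] by exact: lt_nbhsl.
  exact: (@enorm_sqr_continuous R n y _ near_c).
(* The factor [n] converts the Euclidean Lipschitz bound to the maximum norm; the absolute value is
   taken because no sign of [L] is given. *)
exists r, (`|L| * n%:R); split => //.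
move=> u v ur vr; apply: (le_trans (mx_norm_le_enorm _)).
have in_c z : `|z - y| < r -> nball 0 c z.
  by move=> zr; rewrite nballE; apply: Hr; rewrite -ball_normE /ball_ /= distrC.
apply: (le_trans (HL _ _ (in_c _ ur) (in_c _ vr))).
apply: (@le_trans _ _ (`|L| * enorm (u - v))).
  by apply: ler_wpM2r; [exact: enorm_ge0|exact: ler_norm].
by rewrite -mulrA ler_wpM2l// enorm_le.
Qed.

End Sublevel.

Unset Implicit Arguments.
Set Strict Implicit.
Set Printing Implicit Defensive.

Theorem theorem4p1 (R : realType) (n : nat) (f : 'rV[R]_n -> R)
    (lambda q sigma gamma tau alpha : R) (x0 : 'rV[R]_n)
    (w x : nat -> 'rV[R]_n) (xs : 'rV[R]_n)
    (f_C1 : C1_on f setT) (f_bounded : bounded_below f)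
    (lambda_gt0 : 0 < lambda) (q_ge0 : 0 <= q) (q_lt1 : q < 1)
    (sigma_gt0 : 0 < sigma) (gamma_gt0 : 0 < gamma) (gamma_lt1 : gamma < 1)
    (tau_gt0 : 0 < tau) (alpha_gt0 : 0 < alpha)
    (alpha_le : alpha <= Num.min tau (sigma + sigma0 f lambda q tau x0)^-1)
    (grad0_neq0 : grad f 0 != 0)
    (* `| . | is the maximum norm here *)
    (lambda_lt : lambda < alpha `^ (1 - q) / 2 * `|grad f 0| `^ (2 - q))
    (generated : PSNP f lambda q sigma gamma (fun=> alpha) x0 w x \/
                 PCSNP f lambda q sigma gamma (fun=> alpha) x0 w x)
    (f_LC1 : LC1_on f (nball 0 (c0 f lambda q tau x0)))
    (f_coercive : q = 0 -> coercive f)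
    (xs_acc : cluster (x @ \oo) xs) :
  (exists k0 : nat, forall k, (k0 <= k)%N ->
     supp (w k) = supp (x k) /\ supp (x k) = supp xs) /\
  ((forall M, hessE f lambda q xs M ->
      forall v : 'rV[R]_#|supp xs|, v != 0 -> 0 < dotv (v *m M) v) ->
   [/\ x @ \oo --> xs, P_stationary f lambda q alpha xs &
       unique_local_minimizer f lambda q xs]).
Proof.
have df y : differentiable f y by have [] := f_C1 y Logic.I.
have cgrad : continuous (grad f) by move=> y; have [] := f_C1 y Logic.I.
have [fmin f_ge] := f_bounded.
have [x00 steps] := generated_steps sigma_gt0 generated.
have prox_x k : prox_point f lambda q alpha (x k) (w k) by have [[]] := steps k.
have descent_w k : Fobj f lambda q (w k) <=
    Fobj f lambda q (x k) - sigma / 4 * enorm (w k - x k) ^+ 2.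
  by have [[]] := steps k.
have descent_x k : Fobj f lambda q (x k.+1) <=
    Fobj f lambda q (w k) - sigma / 2 * enorm (x k.+1 - w k) ^+ 2.
  by have [] := steps k.
have supp_x k i : w k ord0 i = 0 -> x k.+1 ord0 i = 0.
  by have [_ _] := steps k; exact.
have acc := clusterP xs_acc.
split; first exact: (support_identification f_ge lambda_gt0 q_lt1 sigma_gt0
  alpha_gt0 prox_x descent_w descent_x supp_x acc).
move=> posM.
(* The gradient is known to be Lipschitz only on N(0, c0), so [xs] has to be located there before
   the local growth can be used. *)
have xs_sub : sublevel f lambda q x0 xs.
  rewrite /sublevel /= -x00.
  exact: (Fobj_acc_le df f_ge lambda_gt0 q_lt1 sigma_gt0 alpha_gt0 prox_x
    descent_w descent_x supp_x acc).
have xs_ball := sublevel_nball cgrad f_ge lambda_gt0 q_ge0 tau_gt0 f_coercive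
  grad0_neq0 xs_sub.
have [r [L [r0 L0 lipf]]] := LC1_near f_LC1 xs_ball.
have Pxs : P_stationary f lambda q alpha xs.
  exact: (acc_P_stationary f_ge lambda_gt0 q_lt1 sigma_gt0 alpha_gt0 prox_x
    descent_w descent_x supp_x acc (cgrad xs)).
have growth := local_growth lambda_gt0 q_lt1 alpha_gt0 r0 L0 df lipf Pxs posM.
split => //; have [eta eta0 Heta] := growth.
exact: (iterates_converge df f_ge lambda_gt0 q_lt1 sigma_gt0 alpha_gt0 prox_x
    descent_w descent_x supp_x acc eta0 Heta).
Qed.
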